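(* Let $g$ be a non-negative function defined on $\mathbb{R}^n$, and $q\in\mathbb{R}\cup\{+\infty\}$. Assume that the following conditions are satisfied: (i) $g$ is $q$-concave on $\mathbb{R}^n$. (ii) $\mathbb{R}^n\setminus g^{-1}(0)$ is bounded, and its interior is not empty. (iii) $q\geq 0$. For $(x,t)\in\mathbb{R}^n\times(0,+\infty)$ let $$Wg(x,t)=\frac{1}{(4\pi t)^{n/2}}\int_{\mathbb{R}^n}\exp\left(-\frac{|x-y|^2}{4t}\right)g(y)\,\mathrm{d}y.$$ Then, for any $t\in(0,+\infty)$, the function $Wg(\cdot,t):\mathbb{R}^n\to(0,+\infty)$ is strictly log-concave on $\mathbb{R}^n$.
   Context: For $a,b \in [0,+\infty)$, $\lambda \in [0,1]$ and $p \in \mathbb{R} \cup \{\pm\infty\}$, put $M_p(a,b;\lambda) = 0$ if $ab=0$; and, if $ab>0$, $M_p(a,b;\lambda) = ((1-\lambda)a^p + \lambda b^p)^{1/p}$ for $p \in \mathbb{R}\setminus\{0\}$, $M_0(a,b;\lambda) = a^{1-\lambda}b^\lambda$, $M_{+\infty}(a,b;\lambda) = \max\{a,b\}$, $M_{-\infty}(a,b;\lambda) = \min\{a,b\}$. Write $x_\lambda = (1-\lambda)x_0 + \lambda x_1$. A non-negative function $f$ on a convex set $A \subset \mathbb{R}^n$ is $p$-concave on $A$ if $f(x_\lambda) \geq M_p(f(x_0),f(x_1);\lambda)$ for all $x_0,x_1 \in A$ and $\lambda \in [0,1]$. It is strictly $p$-concave if moreover equality holds in this inequality if and only if $x_0=x_1$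 or $\lambda=0$ or $\lambda=1$. (Strict) log-concavity means (strict) $0$-concavity. *)

(* Defs.v *)
From HB Require Import structures.
From mathcomp Require Import all_boot all_order all_algebra.
From mathcomp Require Import all_classical all_reals all_analysis.

Set Implicit Arguments.
Unset Strict Implicit.
Unset Printing Implicit Defensive.

Import Order.TTheory GRing.Theory Num.Theory.
Import numFieldNormedType.Exports.

Local Open Scope classical_set_scope.
Local Open Scope ring_scope.

(* The product (= Borel) sigma-algebra, generated by the coordinates; compare
   the instance for [n.-tuple T] in MathComp-Analysis. *)
Definition measure_rV_display : measure_display. Proof. exact. Qed.

Section measurable_rV.
Context {R : realType} (n : nat).

Definition coord_rV (i : 'I_n) (x : 'rV[R]_n) : measurableTypeR R := x ord0 i.

Let rV_set0 : g_sigma_preimage coord_rV set0.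
Proof. exact: sigma_algebra0. Qed.

Let rV_setC A : g_sigma_preimage coord_rV A -> g_sigma_preimage coord_rV (~` A).
Proof. exact: sigma_algebraC. Qed.

Let rV_bigcup (F : _^nat) : (forall i, g_sigma_preimage coord_rV (F i)) ->
  g_sigma_preimage coord_rV (\bigcup_i (F i)).
Proof. exact: sigma_algebra_bigcup. Qed.

HB.instance Definition _ := @isMeasurable.Build measure_rV_display
  'rV[R]_n (g_sigma_preimage coord_rV) rV_set0 rV_setC rV_bigcup.

Lemma measurable_coord_rV i : measurable_fun setT (coord_rV i).
Proof.
move=> _ Y mY; rewrite setTI; apply: sub_sigma_algebra => /=.
rewrite -bigcup_seq/=; exists i => /=; first by rewrite mem_index_enum.
by exists Y => //; rewrite setTI.
Qed.

Lemma measurable_fun_rV d (T : measurableType d) (f : T -> 'rV[R]_n) :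
  (forall i, measurable_fun setT (coord_rV i \o f)) -> measurable_fun setT f.
Proof.
move=> mf _ A mA; rewrite setTI.
suff : measurable `<=` [set A | measurable (f @^-1` A)] by move=> /(_ A mA).
apply: smallest_sub.
  split => [|B mB|F mF] /=.
  - by rewrite preimage_set0.
  - by rewrite setTD preimage_setC; exact: measurableC.
  - by rewrite preimage_bigcup; apply: bigcup_measurable => k _; exact: mF.
move=> B; rewrite -bigcup_seq/= => -[i _ [C mC <-]] /=.
by rewrite setTI -comp_preimage -[X in measurable X]setTI; exact: mf.
Qed.

Lemma measurable_rV_box (a b : 'rV[R]_n) :
  measurable [set x : 'rV[R]_n | forall i, a ord0 i < x ord0 i <= b ord0 i].
Proof.
rewrite (_ : mkset _ = \big[setI/setT]_(i < n)
    (coord_rV i @^-1` `]a ord0 i, b ord0 i]%classic)).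
  apply: bigsetI_measurable => i _.
  by rewrite -[X in measurable X]setTI; exact: measurable_coord_rV.
rewrite -bigcap_seq; apply/seteqP; split => x /= H i.
  by move=> _; rewrite /coord_rV /= in_itv; exact: H.
by have := H i; rewrite /coord_rV /= in_itv; apply; rewrite mem_index_enum.
Qed.

End measurable_rV.

Section cons_rV.
Context {R : realType} (n : nat).

Definition cons_rV (z : measurableTypeR R * 'rV[R]_n) : 'rV[R]_n.+1 :=
  row_mx (const_mx z.1 : 'rV_1) z.2.

Definition uncons_rV (x : 'rV[R]_n.+1) : measurableTypeR R * 'rV[R]_n :=
  (x ord0 ord0, \row_i x ord0 (lift ord0 i)).

Lemma cons_rV0 z : cons_rV z ord0 ord0 = z.1.
Proof.
by rewrite mxE; case: splitP => // j _; rewrite mxE.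
Qed.

Lemma cons_rVS z i : cons_rV z ord0 (lift ord0 i) = z.2 ord0 i.
Proof.
rewrite mxE; case: splitP => [j|j /= [ij]]; first by rewrite ord1.
by congr (z.2 _ _); exact/val_inj.
Qed.

Lemma cons_rVK : cancel cons_rV uncons_rV.
Proof.
move=> [a v]; rewrite /uncons_rV cons_rV0; congr pair.
by apply/rowP => i; rewrite mxE cons_rVS.
Qed.

Lemma uncons_rVK : cancel uncons_rV cons_rV.
Proof.
move=> x; apply/rowP => i; case: (unliftP ord0 i) => [j|] ->.
  by rewrite cons_rVS mxE.
by rewrite cons_rV0.
Qed.

Lemma measurable_cons_rV : measurable_fun setT cons_rV.
Proof.
apply: measurable_fun_rV => i; case: (unliftP ord0 i) => [j|] ->.
  rewrite (_ : _ \o _ = coord_rV j \o snd).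
    apply: measurableT_comp; [exact: measurable_coord_rV|exact: measurable_snd].
  by apply/funext => z /=; rewrite /coord_rV cons_rVS.
rewrite (_ : _ \o _ = fst); first exact: measurable_fst.
by apply/funext => z /=; rewrite /coord_rV cons_rV0.
Qed.

Lemma measurable_uncons_rV : measurable_fun setT uncons_rV.
Proof.
apply: measurable_fun_pair; first exact: measurable_coord_rV.
apply: measurable_fun_rV => i.
rewrite (_ : _ \o _ = coord_rV (lift ord0 i)); first exact: measurable_coord_rV.
by apply/funext => x; rewrite /coord_rV /= mxE.
Qed.

End cons_rV.

Section lebesgue_rV_step.
Local Open Scope ereal_scope.
Context {R : realType} (n : nat).
Variable mu : {sigma_finite_measure set 'rV[R]_n -> \bar R}.

Definition lebesgue_rV_step : set 'rV[R]_n.+1 -> \bar R :=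
  pushforward (@lebesgue_measure R \x mu) (@cons_rV R n).

Let step0 : lebesgue_rV_step set0 = 0.
Proof. by rewrite /lebesgue_rV_step /pushforward preimage_set0 measure0. Qed.

Let step_ge0 A : 0 <= lebesgue_rV_step A.
Proof. by rewrite /lebesgue_rV_step /pushforward measure_ge0. Qed.

Let mcons (A : set 'rV[R]_n.+1) : measurable A -> measurable (@cons_rV R n @^-1` A).
Proof. by move=> mA; rewrite -[X in measurable X]setTI; exact: measurable_cons_rV. Qed.

Let step_sigma_additive : semi_sigma_additive lebesgue_rV_step.
Proof.
move=> F mF tF mUF; rewrite /lebesgue_rV_step /pushforward preimage_bigcup.
apply: measure_semi_sigma_additive.
- by move=> k; exact: mcons.
- apply/trivIsetP => /= i j _ _ ij; rewrite -preimage_setI.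
  by move/trivIsetP : tF => /(_ _ _ _ _ ij) ->//; rewrite preimage_set0.
- by rewrite -preimage_bigcup; exact: mcons.
Qed.

HB.instance Definition _ := isMeasure.Build _ _ _
  lebesgue_rV_step step0 step_ge0 step_sigma_additive.

Let step_sigma_finite : sigma_finite setT lebesgue_rV_step.
Proof.
have /sigma_finiteP[F [TF ndF Foo]] := sigma_finiteT (@lebesgue_measure R).
have /sigma_finiteP[G [TG ndG Goo]] := sigma_finiteT mu.
exists (fun k => @uncons_rV R n @^-1` (F k `*` G k)).
  rewrite -preimage_bigcup (_ : \bigcup_k _ = setT) ?preimage_setT//.
  rewrite -subTset -setXTT {1}TF {1}TG => -[x y] /= [[i _ Fx] [j _ Gy]].
  exists (maxn i j) => //; split.
    by move: x Fx; exact/subsetPset/ndF/leq_maxl.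
  by move: y Gy; exact/subsetPset/ndG/leq_maxr.
move=> k; have [mF Fk] := Foo k; have [mG Gk] := Goo k; split.
  rewrite -[X in measurable X]setTI; apply: measurable_uncons_rV => //.
  exact: measurableX.
rewrite /lebesgue_rV_step /pushforward -comp_preimage.
rewrite (_ : _ \o _ = id); last by apply/funext => z; exact: cons_rVK.
by rewrite preimage_id product_measure1E// lte_mul_pinfty// ge0_fin_numE.
Qed.

HB.instance Definition _ := Measure_isSigmaFinite.Build _ _ _
  lebesgue_rV_step step_sigma_finite.

End lebesgue_rV_step.

(* The Borel measure: the product of [n] copies of [lebesgue_measure]; on the
   one-point space [R^0] it is the unit mass. *)
Fixpoint borel_lebesgue_rV (R : realType) (n : nat) :
    {sigma_finite_measure set 'rV[R]_n -> \bar R} :=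
  match n with
  | 0 => dirac (0 : 'rV[R]_0)
  | n'.+1 => lebesgue_rV_step (borel_lebesgue_rV R n')
  end.

Lemma borel_lebesgue_rV_box (R : realType) (n : nat) (a b : 'rV[R]_n) :
  (forall i, a ord0 i <= b ord0 i) ->
  borel_lebesgue_rV R n [set x | forall i, a ord0 i < x ord0 i <= b ord0 i] =
  (\prod_i (b ord0 i - a ord0 i))%:E.
Proof.
elim: n a b => [|n IH] a b ab /=.
  rewrite big_ord0 /dirac indicE mem_set//= => -[]//.
pose a' := \row_(i < n) a ord0 (lift ord0 i); pose b' := \row_(i < n) b ord0 (lift ord0 i).
have E : @cons_rV R n @^-1` [set x | forall i, a ord0 i < x ord0 i <= b ord0 i] =
    `]a ord0 ord0, b ord0 ord0]%classic `*`
    [set x : 'rV[R]_n | forall i, a' ord0 i < x ord0 i <= b' ord0 i].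
  apply/seteqP; split => [z /= H|z /= [H1 H2] i].
    split; first by have := H ord0; rewrite cons_rV0 in_itv.
    by move=> i; have := H (lift ord0 i); rewrite cons_rVS !mxE.
  case: (unliftP ord0 i) => [j|] ->.
    by have := H2 j; rewrite cons_rVS !mxE.
  by rewrite cons_rV0; move: H1; rewrite in_itv.
rewrite /lebesgue_rV_step /pushforward E.
rewrite product_measure1E//; last exact: measurable_rV_box.
rewrite IH; last by move=> i; rewrite !mxE.
rewrite big_ord_recl EFinM; congr (_ * _)%E.
  rewrite [LHS](lebesgue_measure_itv `]a ord0 ord0, b ord0 ord0]) /= lte_fin.
  have := ab ord0.
  rewrite le_eqVlt => /predU1P[->|->//].
  by rewrite ltxx subrr.
by congr EFin; apply: eq_bigr => i _; rewrite !mxE.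
Qed.

(* Its Caratheodory completion, defined on all Lebesgue measurable sets. The
   completion matters: for n >= 2 a p-concave function need not be Borel
   measurable (take the indicator of an open disc together with a non-Borel
   part of its boundary circle), but it is Lebesgue measurable. *)
Definition lebesgue_rV (R : realType) (n : nat) :=
  @completed_measure_extension _ _ _ (borel_lebesgue_rV R n).
Arguments lebesgue_rV : clear implicits.
HB.instance Definition _ (R : realType) (n : nat) :=
  Measure.on (lebesgue_rV R n).

Lemma lebesgue_rVE (R : realType) (n : nat) (A : set 'rV[R]_n) :
  measurable A -> lebesgue_rV R n A = borel_lebesgue_rV R n A.
Proof. exact: measurable_mu_extE. Qed.

Section power_mean.
Context {R : realType}.

Definition power_mean (p : \bar R) (a b l : R) : R :=
  if a * b == 0 then 0 else
  match p with
  | r%:E => if r == 0 then a `^ (1 - l) * b `^ l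
            else ((1 - l) * a `^ r + l * b `^ r) `^ r^-1
  | +oo%E => Num.max a b
  | -oo%E => Num.min a b
  end.

Context {V : lmodType R}.

Definition pconcave (p : \bar R) (A : set V) (f : V -> R) : Prop :=
  [/\ convex_set A,
      forall x, A x -> 0 <= f x
    & forall x0 x1 (l : R), A x0 -> A x1 -> 0 <= l <= 1 ->
        power_mean p (f x0) (f x1) l <= f ((1 - l) *: x0 + l *: x1)].

Definition strictly_pconcave (p : \bar R) (A : set V) (f : V -> R) : Prop :=
  pconcave p A f /\
  forall x0 x1 (l : R), A x0 -> A x1 -> 0 <= l <= 1 ->
    f ((1 - l) *: x0 + l *: x1) = power_mean p (f x0) (f x1) l <->
    [\/ x0 = x1, l = 0 | l = 1].

Definition strictly_log_concave := strictly_pconcave 0%:E.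

End power_mean.

(* [`|x|] is the sup norm on ['rV[R]_n]. *)
Definition euclidean_norm (R : realType) (n : nat) (x : 'rV[R]_n) : R :=
  Num.sqrt (\sum_i x ord0 i ^+ 2).

Definition heat_flow (R : realType) (n : nat) (g : 'rV[R]_n -> R)
    (x : 'rV[R]_n) (t : R) : R :=
  ((4 * pi * t) `^ (n%:R / 2))^-1 *
  \int[lebesgue_rV R n]_y (expR (- euclidean_norm (x - y) ^+ 2 / (4 * t)) * g y).

(* Main.v *)
Require Import Defs.
From HB Require Import structures.
From mathcomp Require Import all_boot all_order all_algebra.
From mathcomp Require Import all_classical all_reals all_analysis.
From mathcomp Require Import ring lra measurable_realfun.

Import Order.TTheory GRing.Theory Num.Theory.
Import numFieldNormedType.Exports.

Local Open Scope classical_set_scope.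
Local Open Scope ring_scope.

(* Since [q >= 0], [g] is log-concave. The boundary of its bounded convex support
   is Lebesgue null and [g] is lower semicontinuous in the interior, so [g] may be
   replaced by a Borel function and the completed integral by an iterated one.
   Fix [x0 != x1] and write [k_j y] for the heat kernel at [x_j]. With
   [w = (x0 - x1) - (y0 - y1)], the parallelogram identity gives
     [k_l (y_l) = k_0 (y0) ^ (1 - l) * k_1 (y1) ^ l * exp (l (1 - l) |w|^2 / 4t)],
   and the Prekopa-Leindler inequality yields log-concavity. For strictness, let
   [i] be such that [x0_i > x1_i]: if [y0] lies close to the end of the support
   where the coordinate [i] is smallest, then [w_i] is bounded below uniformly in
   [y1], because [y1_i] cannot be much smaller than [y0_i]. There the exponential
   factor can be absorbed in the first function, whose integral strictly
   increases, before Prekopa-Leindler is applied. *)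

(** * Power means *)

(** Young's inequality with the conjugate exponents [(1 - l)^-1] and [l^-1], applied to
    [a ^ (1 - l)] and [b ^ l]. *)
Lemma powR_weighted_AMGM (R : realType) (a b l : R) :
  0 <= a -> 0 <= b -> 0 < l < 1 ->
  a `^ (1 - l) * b `^ l <= (1 - l) * a + l * b.
Proof.
move=> a0 b0 /andP[l0 l1]; have l1' : 0 < 1 - l by rewrite subr_gt0.
have := @conjugate_powR R (a `^ (1 - l)) (b `^ l) (1 - l)^-1 l^-1
  (powR_ge0 _ _) (powR_ge0 _ _).
rewrite !invr_gt0 !invrK subrK => /(_ l1' l0 (erefl _)).
by rewrite -!powRrM !divff ?gt_eqF// !powRr1// [a * _]mulrC [b * _]mulrC.
Qed.

(** For finite [q > 0], apply weighted AM-GM to the [q]-th powers and take the root; for [q = +oo],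
    bound both factors by the maximum. If [a * b = 0], the left side vanishes because both exponents
    are positive. *)
Lemma power_mean0_le (R : realType) (q : \bar R) (a b l : R) :
  (0 <= q)%E -> 0 <= a -> 0 <= b -> 0 < l < 1 ->
  a `^ (1 - l) * b `^ l <= power_mean q a b l.
Proof.
move=> q0 a0 b0 l01; have [l0 l1] := andP l01.
have l1' : 0 < 1 - l by rewrite subr_gt0.
rewrite /power_mean; case: ifPn => [|].
  rewrite mulf_eq0 => /orP[] /eqP ->; rewrite [0 `^ _]powR0 ?mul0r ?mulr0 ?gt_eqF ?lexx//.
rewrite mulf_eq0 negb_or => /andP[aN0 bN0].
have {}a0 : 0 < a by rewrite lt0r aN0.
have {}b0 : 0 < b by rewrite lt0r bN0.
case: q q0 => [r| |//] q0.
  case: ifPn => // rN0; have {}r0 : 0 < r by rewrite lt0r rN0 -lee_fin.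
  have := @powR_weighted_AMGM R (a `^ r) (b `^ r) l (powR_ge0 _ _) (powR_ge0 _ _) l01.
  rewrite -!powRrM => H.
  have E : a `^ (1 - l) * b `^ l = (a `^ (r * (1 - l)) * b `^ (r * l)) `^ r^-1.
    rewrite powRM ?powR_ge0// -!powRrM.
    by rewrite ![r * _]mulrC !mulfK.
  rewrite E; apply: ge0_ler_powR; rewrite ?nnegrE ?invr_ge0 ?(ltW r0)//.
    by rewrite mulr_ge0 ?powR_ge0.
  by rewrite addr_ge0// mulr_ge0 ?powR_ge0// ltW.
set m := Num.max a b.
have [am bm] : a <= m /\ b <= m by rewrite !le_max !lexx orbT.
have m0 : 0 < m by exact: lt_le_trans am.
have -> : m = m `^ (1 - l) * m `^ l.
  by rewrite -powRD ?subrK ?powRr1 ?(ltW m0)// oner_eq0.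
by apply: ler_pM; rewrite ?powR_ge0// ge0_ler_powR// ?nnegrE; apply: ltW.
Qed.

(** * The one-dimensional Prekopa-Leindler inequality *)

(** By uniqueness of Lebesgue measure: [c] times its pushforward under the affine map has the right
    value on half-open intervals. *)
Lemma lebesgue_measure_affine (R : realType) (c b : R) (A : set R) :
  0 < c -> measurable A ->
  lebesgue_measure ((fun x => c * x + b) @^-1` A) = (c^-1%:E * lebesgue_measure A)%E.
Proof.
move=> c0 mA.
pose phi := (fun x : measurableTypeR R => c * x + b : measurableTypeR R).
have mphi : measurable_fun setT phi.
  by apply: measurable_funD => //; apply: measurable_realfun.measurable_funM.
pose m := measure_function_pushforward__canonical__measure_function_Measure
  (@lebesgue_measure R) mphi.
pose m' := mscale (NngNum (ltW c0)) m.
suff : lebesgue_measure A = m' A.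
  rewrite /m'/= /mscale /= => ->.
  by rewrite muleA -EFinM mulVf ?gt_eqF// mul1e.
apply: lebesgue_measure_unique => //= _ [[x y] /= xy] <-.
rewrite /m' /= /mscale /= /pushforward.
have -> : phi @^-1` `]x, y] = `](x - b) / c, (y - b) / c]%classic.
  apply/seteqP; split => z; rewrite /= !in_itv /= ltr_pdivrMr// ler_pdivlMr//;
  by rewrite ltrBlDr lerBrDr [z * c]mulrC.
rewrite !lebesgue_measure_itv/= !lte_fin ltr_pM2r ?invr_gt0// ltrD2r.
case: ifPn => xy'; last by rewrite mule0.
by rewrite -!EFinD -EFinM; congr EFin; field; rewrite gt_eqF.
Qed.

(* The translates [(1 - l) K + l min L] and [(1 - l) max K + l L] of two compact
   sets meet in at most one point. *)
Lemma brunn_minkowski1 (R : realType) (l : R) (A B C : set R) : 0 < l < 1 ->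
  measurable A -> measurable B -> measurable C -> A !=set0 -> B !=set0 ->
  (lebesgue_measure A < +oo)%E -> (lebesgue_measure B < +oo)%E ->
  (forall a b, A a -> B b -> C ((1 - l) * a + l * b)) ->
  ((1 - l)%:E * lebesgue_measure A + l%:E * lebesgue_measure B <=
   lebesgue_measure C)%E.
Proof.
move=> /andP[l0 l1] mA mB mC [a0 Aa0] [b0 Bb0] Afin Bfin ABC.
have l1' : 0 < 1 - l by rewrite subr_gt0.
(* Inner regularity may return the empty set; adjoining the point [d0] ensures that the compact set
   has extreme points. *)
have inner (D : set R) d0 (e : R) : measurable D -> D d0 -> (lebesgue_measure D < +oo)%E -> 0 < e ->
    exists K, [/\ compact K, K `<=` D, K !=set0 &
      (lebesgue_measure D <= lebesgue_measure K + e%:E)%E].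
  move=> mD Dd0 Dfin e0; have [K [cK KD KE]] := lebesgue_regularity_inner mD Dfin e0.
  have c1 : compact [set d0] by exact: compact_set1.
  have cK' : compact (K `|` [set d0]) by exact: compactU.
  have mK' : measurable (K `|` [set d0]) by exact: compact_measurable.
  have K'D : K `|` [set d0] `<=` D by rewrite subUset; split => // _ ->.
  exists (K `|` [set d0]); split => //; first by exists d0; right.
  rewrite -(setDUK K'D) measureU//; [|exact: measurableD|by rewrite setDIK].
  rewrite leeD2l// (le_trans _ (ltW KE))// le_measure ?inE//.
  - exact: measurableD.
  - by apply: measurableD => //; exact: compact_measurable.
  - by apply: setDS; exact: subsetUl.
suff H (e : R) : 0 < e -> ((1 - l)%:E * lebesgue_measure A + l%:E * lebesgue_measure B <=
   lebesgue_measure C + e%:E)%E by apply/lee_addgt0Pr.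
move=> e0.
have [K [cK KA [k0 Kk0] KE]] := inner A a0 e mA Aa0 Afin e0.
have [L [cL LB [j0 Lj0] LE]] := inner B b0 e mB Bb0 Bfin e0.
have [M KM Mub] : exists2 M, K M & forall x, K x -> x <= M.
  have [||M KM H] := @compact_EVT_max _ R idfun K _ cK; first by exists k0.
    by apply: continuous_subspaceT => x; exact: cvg_id.
  by exists M => [|x Kx]; [rewrite inE in KM|apply: H; rewrite inE].
have [m Lm mlb] : exists2 m, L m & forall x, L x -> m <= x.
  have [||m Lm H] := @compact_EVT_min _ R idfun L _ cL; first by exists j0.
    by apply: continuous_subspaceT => x; exact: cvg_id.
  by exists m => [|x Lx]; [rewrite inE in Lm|apply: H; rewrite inE].
(* [X] is [(1 - l) K + l m] and [Y] is [(1 - l) M + l L], written as preimages under the inverse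
   affine maps so that their measures are known. *)
pose X := (fun z : R => (1 - l)^-1 * z + (- (1 - l)^-1 * (l * m))) @^-1` K.
pose Y := (fun z : R => l^-1 * z + (- l^-1 * ((1 - l) * M))) @^-1` L.
have mK := compact_measurable cK; have mL := measurable_realfun.compact_measurable cL.
have muX : lebesgue_measure X = ((1 - l)%:E * lebesgue_measure K)%E.
  by rewrite lebesgue_measure_affine ?invrK ?invr_gt0.
have muY : lebesgue_measure Y = (l%:E * lebesgue_measure L)%E.
  by rewrite lebesgue_measure_affine ?invrK ?invr_gt0.
have mX : measurable X.
  rewrite -[X]setTI; apply: (_ : measurable_fun setT _) => //.
  by apply: measurable_funD => //; apply: measurable_realfun.measurable_funM.
have mY : measurable Y.
  rewrite -[Y]setTI; apply: (_ : measurable_fun setT _) => //.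
  by apply: measurable_funD => //; apply: measurable_realfun.measurable_funM.
have XE z : X z -> exists2 k, K k & z = (1 - l) * k + l * m.
  by move=> Xz; eexists; first exact: Xz; field; rewrite gt_eqF.
have YE z : Y z -> exists2 k, L k & z = (1 - l) * M + l * k.
  by move=> Yz; eexists; first exact: Yz; field; rewrite gt_eqF.
(* Points of [X] are at most [p] and points of [Y] at least [p], so removing the null set [[set p]]
   from [X] makes the union disjoint. *)
pose p := (1 - l) * M + l * m.
have dXY : (X `\ p) `&` Y = set0.
  rewrite -subset0 => z [[/XE[k Kk ->] /= zp] /YE[j Lj E]]; apply: zp.
  have h1 := ler_wpM2l (ltW l1') (Mub _ Kk).
  have h2 := ler_wpM2l (ltW l0) (mlb _ Lj).
  rewrite /p; apply/eqP; rewrite eq_le; apply/andP; split; lra.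
have mXp : measurable (X `\ p) by exact: measurableD.
have XYC : (X `\ p) `|` Y `<=` C.
  move=> z [[/XE[k Kk ->] _]|/YE[j Lj ->]]; apply: ABC;
  by [exact: KA|exact: LB].
have muXp : (lebesgue_measure X <= lebesgue_measure (X `\ p))%E.
  have -> : lebesgue_measure (X `\ p) = (lebesgue_measure (X `\ p) + lebesgue_measure [set p])%E.
    by rewrite lebesgue_measure_set1 adde0.
  apply: le_trans (measureU2 _ _ _) => //.
  apply: le_measure; rewrite ?inE//; first exact: measurableU.
  by move=> z Xz; have [->|/eqP zp] := eqVneq z p; [right|left].
have := le_measure lebesgue_measure (mem_set (measurableU _ _ mXp mY)) (mem_set mC) XYC.
rewrite measureU// => CE.
apply: (@le_trans _ _ (lebesgue_measure X + lebesgue_measure Y + e%:E)%E); last first.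
  by rewrite leeD2r// (le_trans _ CE)// leeD2r.
rewrite muX muY.
have -> : e%:E = ((1 - l)%:E * e%:E + l%:E * e%:E)%E.
  by rewrite -!EFinM -EFinD; congr EFin; ring.
rewrite addeACA; apply: leeD.
  by rewrite -ge0_muleDr ?measure_ge0 ?lee_fin ?(ltW e0)// lee_wpmul2l// lee_fin ltW.
by rewrite -ge0_muleDr ?measure_ge0 ?lee_fin ?(ltW e0)// lee_wpmul2l// lee_fin ltW.
Qed.

(** * The layer-cake formula and the functional inequality on the line *)

Section layer_cake.
Context d (T : measurableType d) (R : realType).
Variables (mu : {sigma_finite_measure set T -> \bar R}) (f : T -> R).
Hypothesis mf : measurable_fun setT f.

Let A : set (T * measurableTypeR R) := [set z | 0 <= z.2 < f z.1].

Let mA : measurable A.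
Proof.
have -> : A = [set z | 0 <= z.2] `&` [set z | z.2 < f z.1].
  by apply/seteqP; split=> z; rewrite /A/=; [move/andP|case=> -> ->].
apply: measurableI; rewrite -[X in measurable X]setTI.
  have : measurable_fun setT (fun z : T * measurableTypeR R => 0 <= z.2).
    exact: measurable_fun_ler.
  by move=> /(_ measurableT [set true]); exact.
have : measurable_fun setT (fun z : T * measurableTypeR R => z.2 < f z.1).
  by apply: measurable_fun_ltr => //; apply: measurableT_comp.
by move=> /(_ measurableT [set true]); exact.
Qed.

Let ysectionA r : ysection A r = [set x | 0 <= r < f x].
Proof. by apply/seteqP; split=> x /=; rewrite /ysection/= inE. Qed.

Lemma measurable_superlevel r : measurable [set x | 0 <= r < f x].
Proof. by rewrite -ysectionA; exact: measurable_ysection. Qed.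

Lemma measurable_fun_superlevel :
  measurable_fun setT (fun r : measurableTypeR R => mu [set x | 0 <= r < f x]).
Proof.
rewrite (_ : (fun _ => _) = mu \o ysection A).
  exact: measurable_fun_ysection.
by apply/funext => r /=; rewrite ysectionA.
Qed.

(** Tonelli for the region [A] under the graph: the section over [x] is the interval [[0, f x[], of
    length [f x]. The condition [0 <= r] allows [r] to range over the whole line. *)
Lemma ge0_layer_cake : (forall x, 0 <= f x) ->
  (\int[mu]_x (f x)%:E = \int[lebesgue_measure]_r mu [set x | (0 <= r < f x)%R])%E.
Proof.
move=> f0.
have := @indic_fubini_tonelli _ _ _ _ R mu lebesgue_measure A mA.
rewrite indic_fubini_tonelli_FE// indic_fubini_tonelli_GE// => H.
transitivity (\int[mu]_x (lebesgue_measure \o xsection A) x)%E.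
  apply: eq_integral => x _ /=.
  rewrite (_ : xsection A x = `[0, f x[%classic); last first.
    by apply/seteqP; split=> r /=; rewrite /xsection/= inE /A/= in_itv.
  rewrite lebesgue_measure_itv/= lte_fin; case: ifPn => [_|].
    by rewrite sube0.
  by rewrite -leNgt => fx; have -> : f x = 0 by apply/eqP; rewrite eq_le fx f0.
by rewrite H; apply: eq_integral => r _ /=; rewrite ysectionA.
Qed.

End layer_cake.

(** With both suprema equal to 1, the superlevel sets of [f] and [g] are nonempty for exactly the
    same levels [r] in [[0, 1[]. The one-dimensional Brunn-Minkowski inequality holds at each such
    level and is integrated over [r]; the result has an arithmetic mean on the left. *)
Lemma prekopa_leindler1_normalized (R : realType) (l M : R) (f g h : R -> R) :
  0 < l < 1 ->
  measurable_fun setT f -> measurable_fun setT g -> measurable_fun setT h ->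
  (forall x, 0 <= f x <= 1) -> (forall x, 0 <= g x <= 1) -> (forall x, 0 <= h x) ->
  (forall x, f x != 0 -> `|x| <= M) -> (forall x, g x != 0 -> `|x| <= M) ->
  (forall r, r < 1 -> exists x, r < f x) ->
  (forall r, r < 1 -> exists x, r < g x) ->
  (forall x y, f x `^ (1 - l) * g y `^ l <= h ((1 - l) * x + l * y)) ->
  ((1 - l)%:E * \int[lebesgue_measure]_x (f x)%:E +
   l%:E * \int[lebesgue_measure]_x (g x)%:E <=
   \int[lebesgue_measure]_x (h x)%:E)%E.
Proof.
move=> l01 mf mg mh f01 g01 h0 fM gM fsup gsup fgh.
have [l0 l1] := andP l01; have l1' : 0 < 1 - l by rewrite subr_gt0.
have f0 x : 0 <= f x by case/andP: (f01 x).
have g0 x : 0 <= g x by case/andP: (g01 x).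
rewrite !ge0_layer_cake// -!ge0_integralZl_EFin//; try
  by [exact: measurable_fun_superlevel|exact: ltW].
rewrite -ge0_integralD//; last 4 first.
- by move=> r _; rewrite mule_ge0// lee_fin ltW.
- by apply: measurable_funeM; exact: measurable_fun_superlevel.
- by move=> r _; rewrite mule_ge0// lee_fin ltW.
- by apply: measurable_funeM; exact: measurable_fun_superlevel.
have lvl_fin (k : R -> R) r : measurable_fun setT k -> (forall x, k x != 0 -> `|x| <= M) ->
    (lebesgue_measure [set x | (0 <= r < k x)%R] < +oo)%E.
  move=> mk kM; apply: (@le_lt_trans _ _ (lebesgue_measure `[- M, M]%classic)).
    apply: le_measure; rewrite ?inE//; first exact: measurable_superlevel.
    move=> x /= /andP[r0 rk]; rewrite in_itv/= -ler_norml; apply: kM.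
    by rewrite gt_eqF// (le_lt_trans r0).
  by rewrite lebesgue_measure_itv/=; case: ifPn => // _; rewrite -EFinD ltry.
apply: ge0_le_integral => //.
- by move=> r _; rewrite adde_ge0// mule_ge0// lee_fin ltW.
- by apply: emeasurable_funD; apply: measurable_funeM; exact: measurable_fun_superlevel.
- exact: measurable_fun_superlevel.
(* Outside [[0, 1[] the level sets of [f] and [g] are empty, so the left side is 0. *)
move=> r _; have [/andP[r0 r1]|r01] := boolP (0 <= r < 1); last first.
  have E (k : R -> R) : (forall x, 0 <= k x <= 1) ->
      lebesgue_measure [set x | (0 <= r < k x)%R] = 0%E.
    move=> k01; rewrite (_ : [set x | _] = set0) ?measure0// -subset0 => x.
    move=> /= /andP[r0 rk]; move: r01.
    by rewrite r0 (lt_le_trans rk)//; case/andP: (k01 x).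
  by rewrite /= (E _ f01) (E _ g01) !mule0 adde0.
apply: brunn_minkowski1 => //; try exact: measurable_superlevel.
- by have [x rx] := fsup r r1; exists x; rewrite /= r0.
- by have [x rx] := gsup r r1; exists x; rewrite /= r0.
- exact: lvl_fin.
- exact: lvl_fin.
move=> x y /= /andP[_ rx] /andP[_ ry]; rewrite r0/=; apply: lt_le_trans (fgh x y).
have [->|rN0] := eqVneq r 0.
  by rewrite mulr_gt0// powR_gt0// (le_lt_trans r0).
have {}r0 : 0 < r by rewrite lt0r rN0.
rewrite -[ltLHS]powRr1 ?(ltW r0)// -[X in r `^ X](subrK l) powRD ?rN0 ?implybT//.
by apply: ltr_pM; rewrite ?powR_ge0// gt0_ltr_powR// ?nnegrE ?(ltW r0)//.
Qed.

Lemma ge0_bounded_integral_le d (T : measurableType d) (R : realType)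
    (mu : {measure set T -> \bar R}) (f : T -> R) (M : R) (B : set T) : 0 <= M ->
  measurable B -> measurable_fun setT f ->
  (forall x, 0 <= f x <= M) -> (forall x, f x != 0 -> B x) ->
  (\int[mu]_x (f x)%:E <= M%:E * mu B)%E.
Proof.
move=> M0 mB mf f0M fB.
have -> : (\int[mu]_x (f x)%:E = \int[mu]_(x in B) (f x)%:E)%E.
  rewrite [RHS]integral_mkcond; apply: eq_integral => x _; rewrite patchE.
  case: ifPn => //; rewrite notin_setE => nB; congr EFin.
  by apply/eqP/negPn/negP => /fB.
rewrite -integral_cst//; apply: ge0_le_integral => //.
- by move=> x _; rewrite lee_fin; case/andP: (f0M x).
- by apply/measurable_EFinP; exact: measurable_funTS.
- by move=> x _; rewrite lee_fin; case/andP: (f0M x).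
Qed.

Lemma ge0_bounded_integral_fin_num d (T : measurableType d) (R : realType)
    (mu : {measure set T -> \bar R}) (f : T -> R) (M : R) (B : set T) : 0 <= M ->
  measurable B -> (mu B < +oo)%E -> measurable_fun setT f ->
  (forall x, 0 <= f x <= M) -> (forall x, f x != 0 -> B x) ->
  (\int[mu]_x (f x)%:E)%E \is a fin_num.
Proof.
move=> M0 mB Bfin mf f0M fB; rewrite ge0_fin_numE; last first.
  by apply: integral_ge0 => x _; rewrite lee_fin; case/andP: (f0M x).
apply: le_lt_trans (ge0_bounded_integral_le _ _ _ _ _ _ _ M0 mB mf f0M fB) _.
by rewrite lte_mul_pinfty.
Qed.

(** Dividing [f] and [g] by their suprema [a] and [b], and [h] by [a ^ (1 - l) * b ^ l], preserves
    the pointwise hypothesis and reduces to the normalized case. Weighted AM-GM then passes from the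
    arithmetic to the geometric mean. If [f] or [g] vanishes identically, the left side is 0. *)
Lemma prekopa_leindler1 (R : realType) (l M : R) (f g h : R -> R) :
  0 < l < 1 ->
  measurable_fun setT f -> measurable_fun setT g -> measurable_fun setT h ->
  (forall x, 0 <= f x <= M) -> (forall x, 0 <= g x <= M) -> (forall x, 0 <= h x <= M) ->
  (forall x, f x != 0 -> `|x| <= M) -> (forall x, g x != 0 -> `|x| <= M) ->
  (forall x, h x != 0 -> `|x| <= M) ->
  (forall x y, f x `^ (1 - l) * g y `^ l <= h ((1 - l) * x + l * y)) ->
  (\int[lebesgue_measure]_x f x) `^ (1 - l) * (\int[lebesgue_measure]_x g x) `^ l <=
  \int[lebesgue_measure]_x h x.
Proof.
move=> l01 mf mg mh f0M g0M h0M fM gM hM fgh.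
have [l0 l1] := andP l01; have l1' : 0 < 1 - l by rewrite subr_gt0.
have f0 x : 0 <= f x by case/andP: (f0M x).
have g0 x : 0 <= g x by case/andP: (g0M x).
have h0 x : 0 <= h x by case/andP: (h0M x).
have intfin (k : R -> R) : measurable_fun setT k -> (forall x, 0 <= k x <= M) ->
    (forall x, k x != 0 -> `|x| <= M) ->
    (\int[lebesgue_measure]_x (k x)%:E)%E \is a fin_num.
  move=> mk k0M kM; apply: (@ge0_bounded_integral_fin_num _ _ R lebesgue_measure k M `[- M, M]%classic) => //.
  - by case/andP: (k0M 0) => /le_trans; exact.
  - by rewrite [ltLHS]lebesgue_measure_itv/=; case: ifPn => // _; rewrite -EFinD ltry.
  - by move=> x /kM; rewrite /= in_itv/= ler_norml.
have zero (k : R -> R) : (forall x, 0 <= k x) -> ~ (exists x, 0 < k x) ->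
    \int[lebesgue_measure]_x k x = 0.
  move=> k0 nk; rewrite /Rintegral integral0_eq// => x _ /=; congr EFin.
  apply/eqP; rewrite eq_le k0 andbT leNgt; apply/negP => kx.
  by apply: nk; exists x.
have h_ge0 : 0 <= \int[lebesgue_measure]_x h x.
  by apply: Rintegral_ge0.
have [[x0 fx0]|/(zero _ f0) ->] := pselect (exists x, 0 < f x); last first.
  by rewrite powR0 ?gt_eqF// mul0r.
have [[y0 gy0]|/(zero _ g0) ->] := pselect (exists x, 0 < g x); last first.
  by rewrite [X in _ * X]powR0 ?gt_eqF// mulr0.
have supP (k : R -> R) x : (forall x, 0 <= k x <= M) -> 0 < k x ->
    [/\ 0 < sup (range k), forall x, k x <= sup (range k) &
    forall r, r < sup (range k) -> exists x, r < k x].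
  move=> k0M kx; have hs : has_sup (range k).
    by split; [exists (k x), x|exists M => _ [y _ <-]; case/andP: (k0M y)].
  have ub y : k y <= sup (range k) by apply: sup_ubound; [case: hs|exists y].
  split => //; first exact: lt_le_trans (ub x).
  by move=> r /sup_gt[]; [case: hs|move=> _ [y _ <-] ?; exists y].
have [a0 fa fsup] := supP f x0 f0M fx0.
have [b0 gb gsup] := supP g y0 g0M gy0.
set a := sup (range f) in a0 fa fsup; set b := sup (range g) in b0 gb gsup.
pose c := a `^ (1 - l) * b `^ l.
have c0 : 0 < c by rewrite mulr_gt0 ?powR_gt0.
have mZ (k : R -> R) (z : R) : measurable_fun setT k -> measurable_fun setT (fun x => z^-1 * k x).
  by move=> mk; exact: measurable_funM.
have iZ (k : R -> R) (z : R) : measurable_fun setT k -> (forall x, 0 <= k x <= M) ->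
    (forall x, k x != 0 -> `|x| <= M) -> 0 < z ->
    (\int[lebesgue_measure]_x (z^-1 * k x)%:E)%E = (z^-1 * \int[lebesgue_measure]_x k x)%:E.
  move=> mk k0M kM z0; under eq_integral do rewrite EFinM.
  rewrite ge0_integralZl_EFin ?invr_ge0 ?ltW//; last 2 first.
  - by move=> x _; rewrite lee_fin; case/andP: (k0M x).
  - exact/measurable_EFinP.
  by rewrite EFinM /Rintegral fineK// intfin.
have := @prekopa_leindler1_normalized R l M (fun x => a^-1 * f x) (fun x => b^-1 * g x)
  (fun x => c^-1 * h x) l01 (mZ _ a mf) (mZ _ b mg) (mZ _ c mh).
rewrite !iZ// -!EFinM -EFinD lee_fin.
have P1 (k : R -> R) (z : R) : 0 < z -> (forall x, 0 <= k x) -> (forall x, k x <= z) ->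
    forall x, 0 <= z^-1 * k x <= 1.
  move=> z0 k0 kz x; rewrite mulr_ge0 ?invr_ge0 ?(ltW z0)//=.
  by rewrite mulrC ler_pdivrMr// mul1r.
have P2 (k : R -> R) (z : R) : (forall x, k x != 0 -> `|x| <= M) ->
    forall x, z^-1 * k x != 0 -> `|x| <= M.
  by move=> kM x; rewrite mulf_eq0 negb_or => /andP[_ /kM].
have P3 (k : R -> R) (z : R) : 0 < z -> (forall r, r < z -> exists x, r < k x) ->
    forall r, r < 1 -> exists x, r < z^-1 * k x.
  move=> z0 kz r r1; have [|x rx] := kz (r * z); first by rewrite gtr_pMl.
  by exists x; rewrite mulrC ltr_pdivlMr.
have Ef : (a^-1 * \int[lebesgue_measure]_x f x) `^ (1 - l) *
    (b^-1 * \int[lebesgue_measure]_x g x) `^ l =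
    c^-1 * ((\int[lebesgue_measure]_x f x) `^ (1 - l) * (\int[lebesgue_measure]_x g x) `^ l).
  rewrite !powRM ?Rintegral_ge0 ?invr_ge0 ?(ltW a0) ?(ltW b0)//.
  rewrite -!powR_inv1 ?(ltW a0) ?(ltW b0) ?(ltW c0)// -!powRrM ![-1 * _]mulrC !powRrM.
  by rewrite /c powRM ?powR_ge0// mulrACA.
move=> H.
have {}H := H (P1 _ _ a0 f0 fa) (P1 _ _ b0 g0 gb).
rewrite -(ler_pM2l (_ : 0 < c^-1)) ?invr_gt0// -Ef.
apply: le_trans (powR_weighted_AMGM _ _ _ _ _ _ l01) _; rewrite ?mulr_ge0 ?invr_ge0 ?Rintegral_ge0 ?(ltW a0) ?(ltW b0)//.
apply: H.
- by move=> x; rewrite mulr_ge0// invr_ge0 ltW.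
- exact: P2.
- exact: P2.
- exact: P3.
- exact: P3.
move=> x y; rewrite /= !powRM ?invr_ge0 ?(ltW a0) ?(ltW b0)//.
rewrite mulrACA -!powR_inv1 ?(ltW a0) ?(ltW b0) ?(ltW c0)// -!powRrM ![-1 * _]mulrC !powRrM.
by rewrite -powRM ?powR_ge0// ler_wpM2l ?powR_ge0.
Qed.

(** * The Prekopa-Leindler inequality in several variables *)

Lemma cons_rV_convex (R : realType) (n : nat) (l : R) (s t : R) (u v : 'rV[R]_n) :
  cons_rV ((1 - l) * s + l * t, (1 - l) *: u + l *: v) =
  (1 - l) *: cons_rV (s, u) + l *: cons_rV (t, v).
Proof.
apply/rowP => i; rewrite [RHS]mxE [X in _ = X + _]mxE [X in _ = _ + X]mxE.
case: (unliftP ord0 i) => [j|] ->; first by rewrite !cons_rVS !mxE.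
by rewrite !cons_rV0.
Qed.

Lemma measurable_fun_cons_rV_slice (R : realType) (n : nat) (f : 'rV[R]_n.+1 -> R) (s : R) :
  measurable_fun setT f -> measurable_fun setT (fun v : 'rV[R]_n => f (cons_rV (s, v))).
Proof.
move=> mf; apply: measurableT_comp => //.
apply: measurableT_comp; first exact: measurable_cons_rV.
exact: measurable_fun_pair.
Qed.

(** The measure is by construction the pushforward of a product measure, so this is a change of
    variables followed by Tonelli. *)
Lemma integral_cons_rV (R : realType) (n : nat) (f : 'rV[R]_n.+1 -> R) :
  measurable_fun setT f -> (forall x, 0 <= f x) ->
  (\int[borel_lebesgue_rV R n.+1]_x (f x)%:E =
   \int[lebesgue_measure]_s \int[borel_lebesgue_rV R n]_v (f (cons_rV (s, v)))%:E)%E.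
Proof.
move=> mf f0.
transitivity (\int[pushforward (lebesgue_measure \x borel_lebesgue_rV R n)%E (@cons_rV R n)]_x (f x)%:E)%E.
  by apply: eq_measure_integral => *; first exact: measurable_cons_rV.
rewrite ge0_integral_pushforward//; last 3 first.
- exact: measurable_cons_rV.
- exact/measurable_EFinP.
- by move=> x _; rewrite lee_fin.
rewrite preimage_setT fubini_tonelli1//.
- apply/measurable_EFinP; apply: measurableT_comp => //; exact: measurable_cons_rV.
- by move=> x /=; rewrite lee_fin.
Qed.

Lemma measurable_fun_integral_cons_rV (R : realType) (n : nat) (f : 'rV[R]_n.+1 -> R) :
  measurable_fun setT f -> (forall x, 0 <= f x) ->
  measurable_fun setT (fun s : R => \int[borel_lebesgue_rV R n]_v f (cons_rV (s, v))).
Proof.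
move=> mf f0; rewrite /Rintegral.
apply: (@measurableT_comp _ _ _ _ _ _ (@fine R)) => //.
apply: (@measurable_fun_fubini_tonelli_F _ _ _ _ R (borel_lebesgue_rV R n)
  (fun z => (f (cons_rV z))%:E)).
- apply/measurable_EFinP; apply: measurableT_comp => //; exact: measurable_cons_rV.
- by move=> x /=; rewrite lee_fin.
Qed.

(** A single constant bounds the values and the coordinates of the support, which makes every
    integral finite and leaves one parameter to carry through the induction on the dimension. *)
Definition boxed (R : realType) (n : nat) (M : R) (f : 'rV[R]_n -> R) : Prop :=
  [/\ measurable_fun setT f, forall x, 0 <= f x <= M &
      forall x, f x != 0 -> forall i, `|x ord0 i| <= M].

Lemma boxed_integral (R : realType) (n : nat) (M : R) : exists K : R, 0 <= K /\
  forall f : 'rV[R]_n -> R, boxed R n M f ->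
    (\int[borel_lebesgue_rV R n]_x (f x)%:E)%E \is a fin_num /\
    \int[borel_lebesgue_rV R n]_x f x <= K.
Proof.
(* Boxes are open on the left; the extra 1 keeps the face at [- M] inside. *)
pose a : 'rV[R]_n := const_mx (- M - 1); pose b : 'rV[R]_n := const_mx M.
pose B := [set x : 'rV[R]_n | forall i, a ord0 i < x ord0 i <= b ord0 i].
pose P := \prod_(i < n) (b ord0 i - a ord0 i).
exists (`|M| * `|P|); split => [|f [mf f0M fM]]; first by rewrite mulr_ge0.
have M0 : 0 <= M by case/andP: (f0M 0) => /le_trans; exact.
have mB : measurable B by exact: measurable_rV_box.
have BE : borel_lebesgue_rV R n B = P%:E.
  by apply: borel_lebesgue_rV_box => i; rewrite !mxE; lra.
have fB x : f x != 0 -> B x.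
  move=> /fM + i => /(_ i); rewrite ler_norml => /andP[h1 h2].
  by rewrite !mxE h2 andbT; lra.
have H := ge0_bounded_integral_le _ _ _ (borel_lebesgue_rV R n) f M B M0 mB mf f0M fB.
have fin : (\int[borel_lebesgue_rV R n]_x (f x)%:E)%E \is a fin_num.
  apply: (ge0_bounded_integral_fin_num _ _ _ (borel_lebesgue_rV R n) f M B) => //.
  by rewrite [ltLHS]BE ltry.
split => //; rewrite -lee_fin /Rintegral fineK// (le_trans H)// [X in (_ * X)%E]BE -EFinM lee_fin.
by rewrite -normrM ler_norm.
Qed.

(** Induction on the dimension: for fixed first coordinates [s] and [t] the slices satisfy the
    hypothesis in dimension [n], so the slice integrals [F] satisfy the hypothesis on the line. In
    dimension 0 the integral is evaluation at the only point. *)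
Lemma prekopa_leindler (R : realType) (n : nat) (l M : R) (f g h : 'rV[R]_n -> R) :
  0 < l < 1 -> boxed R n M f -> boxed R n M g -> boxed R n M h ->
  (forall x y, f x `^ (1 - l) * g y `^ l <= h ((1 - l) *: x + l *: y)) ->
  (\int[borel_lebesgue_rV R n]_x f x) `^ (1 - l) *
    (\int[borel_lebesgue_rV R n]_x g x) `^ l <=
  \int[borel_lebesgue_rV R n]_x h x.
Proof.
move=> l01; elim: n => [|n IH] in f g h *.
  move=> [mf _ _] [mg _ _] [mh _ _] fgh.
  have E (k : 'rV[R]_0 -> R) : measurable_fun setT k ->
      \int[borel_lebesgue_rV R 0]_x k x = k 0.
    move=> mk; rewrite /Rintegral /= integral_dirac//.
      by rewrite diracT mul1e.
    exact/measurable_EFinP.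
  by rewrite !E// (le_trans (fgh 0 0))// !scaler0 addr0.
move=> bf bg bh fgh.
have [K [K0 HK]] := boxed_integral R n M.
pose F (k : 'rV[R]_n.+1 -> R) s := \int[borel_lebesgue_rV R n]_v k (cons_rV (s, v)).
have slice k s : boxed R n.+1 M k -> boxed R n M (fun v => k (cons_rV (s, v))).
  move=> [mk k0M kM]; split; first exact: measurable_fun_cons_rV_slice.
    by move=> x; exact: k0M.
  by move=> v /kM + i => /(_ (lift ord0 i)); rewrite cons_rVS.
have FE k : boxed R n.+1 M k ->
    \int[borel_lebesgue_rV R n.+1]_x k x = \int[lebesgue_measure]_s F k s.
  move=> bk; have [mk k0M _] := bk; rewrite /Rintegral integral_cons_rV//.
    congr fine; apply: eq_integral => s _.
    by rewrite /F /Rintegral fineK//; have [] := HK _ (slice k s bk).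
  by move=> x; case/andP: (k0M x).
have M0 : 0 <= M by case: bf => _ /(_ 0) /andP[a b] _; exact: le_trans b.
have Fm k : boxed R n.+1 M k -> measurable_fun setT (F k).
  move=> [mk k0M _]; apply: measurable_fun_integral_cons_rV => // x.
  by case/andP: (k0M x).
have Fb k : boxed R n.+1 M k -> forall s, 0 <= F k s <= M + K.
  move=> bk s; have [_ kK] := HK _ (slice k s bk).
  have [_ k0M _] := bk.
  rewrite (le_trans kK) ?lerDr// andbT Rintegral_ge0// => x _.
  by case/andP: (k0M (cons_rV (s, x))).
have Fs k : boxed R n.+1 M k -> forall s, F k s != 0 -> `|s| <= M + K.
  move=> bk s; have [_ k0M kM] := bk; apply: contraNT; rewrite -ltNge => sM.
  rewrite /F /Rintegral integral0_eq// => v _; congr EFin.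
  apply/eqP/negPn/negP => /kM /(_ ord0); rewrite cons_rV0/=.
  by apply/negP; rewrite -ltNge (le_lt_trans _ sM)// lerDl.
(* The slice integrals are at most [K] and vanish outside [[- M, M]]; [M + K] dominates both
   bounds. *)
rewrite !FE//; apply: (@prekopa_leindler1 R l (M + K)) => //; try by [exact: Fm|exact: Fb|exact: Fs].
move=> s t; apply: IH; try exact: slice.
by move=> u v; rewrite cons_rV_convex; exact: fgh.
Qed.

(** * Lebesgue measure of open and of convex sets *)

(** Balls of the sup norm are cubes. *)
Lemma interior_rV (R : realType) (n : nat) (D : set 'rV[R]_n) (p : 'rV[R]_n) :
  interior D p <-> exists e : R, 0 < e /\
    forall y : 'rV[R]_n, (forall i, `|y ord0 i - p ord0 i| < e) -> D y.
Proof.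
split=> [/nbhs_ballP[e /= e0 eD]|[e [e0 eD]]].
  exists e; split => // y yp; apply: eD; split => // i j.
  by rewrite ord1 /ball/= distrC.
apply/nbhs_ballP; exists e => //= y [_ yp]; apply: eD => i.
by have := yp ord0 i; rewrite /ball/= distrC.
Qed.

Lemma open_rV_box (R : realType) (n : nat) (U : set 'rV[R]_n) (x : 'rV[R]_n) :
  open U -> U x -> exists e : R, 0 < e /\
    forall y : 'rV[R]_n, (forall i, `|y ord0 i - x ord0 i| < e) -> U y.
Proof. by rewrite openE => UU Ux; apply/interior_rV; exact: UU. Qed.

(** An open set is the countable union of the boxes with rational corners that it contains; the
    other boxes are replaced by the empty set. *)
Lemma rV_open_measurable (R : realType) (n : nat) (U : set 'rV[R]_n) :
  open U -> measurable U.
Proof.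
move=> oU.
pose box (p : 'rV[rat]_n * 'rV[rat]_n) : set 'rV[R]_n := [set x | forall i,
  (map_mx ratr p.1 : 'rV[R]_n) ord0 i < x ord0 i <= (map_mx ratr p.2 : 'rV[R]_n) ord0 i].
pose F p := if pselect (box p `<=` U) then box p else set0.
rewrite (_ : U = \bigcup_p F p); last first.
  apply/seteqP; split=> [x Ux|x [p _]]; last first.
    by rewrite /F; case: pselect => [h|_ []] /=; exact: h.
  have [e [e0 eU]] := open_rV_box _ _ _ _ oU Ux.
  have aE i : exists q : rat, x ord0 i - e < ratr q < x ord0 i.
    have /rat_in_itvoo[q] : x ord0 i - e < x ord0 i by rewrite ltrBlDr ltrDl.
    by rewrite in_itv/= => ?; exists q.
  have bE i : exists q : rat, x ord0 i < ratr q < x ord0 i + e.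
    have /rat_in_itvoo[q] : x ord0 i < x ord0 i + e by rewrite ltrDl.
    by rewrite in_itv/= => ?; exists q.
  have [[a aP] [b bP]] := (choice aE, choice bE).
  exists (\row_i a i, \row_i b i) => //; rewrite /F; case: pselect => [abU|[]] /=.
    move=> i; rewrite !mxE; have /andP[_ ->] := aP i.
    by have /andP[/ltW ->] := bP i.
  move=> y yab; apply: eU => i; have := yab i; rewrite !mxE.
  have := aP i; have := bP i; rewrite ltr_norml => /andP[h1 h2] /andP[h3 h4] /andP[h5 h6].
  by apply/andP; split; lra.
apply: countable_bigcupT_measurable; first exact: countableP.
move=> p; rewrite /F; case: pselect => [pU|pU] /=; last exact: measurable0.
exact: (measurable_rV_box (map_mx ratr p.1) (map_mx ratr p.2)).
Qed.

Lemma borel_lebesgue_rV_open_gt0 (R : realType) (n : nat) (U : set 'rV[R]_n) :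
  open U -> U !=set0 -> (0 < borel_lebesgue_rV R n U)%E.
Proof.
move=> oU [x Ux]; have [e [e0 eU]] := open_rV_box _ _ _ _ oU Ux.
pose a : 'rV[R]_n := \row_i (x ord0 i - e / 2).
pose b : 'rV[R]_n := \row_i (x ord0 i + e / 2).
pose B := [set x : 'rV[R]_n | forall i, a ord0 i < x ord0 i <= b ord0 i].
apply: (@lt_le_trans _ _ (borel_lebesgue_rV R n B)).
  rewrite borel_lebesgue_rV_box; last by move=> i; rewrite !mxE; lra.
  by rewrite lte_fin prodr_gt0// => i _; rewrite !mxE; lra.
apply: le_measure; rewrite ?inE; [exact: measurable_rV_box|exact: rV_open_measurable|].
move=> y By; apply: eU => i; have := By i; rewrite !mxE ltr_norml => /andP[h1 h2].
by apply/andP; split; lra.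
Qed.

(** Induction on the dimension: [c ^+ n.+1] times the pushforward of the product measure under the
    affine map agrees with the product measure on rectangles, which determine it. *)
Lemma borel_lebesgue_rV_affine (R : realType) (n : nat) (c : R) (b : 'rV[R]_n)
    (A : set 'rV[R]_n) : 0 < c -> measurable A ->
  borel_lebesgue_rV R n ((fun x => c *: x + b) @^-1` A) =
  ((c ^- n)%:E * borel_lebesgue_rV R n A)%E.
Proof.
move=> c0; elim: n => [|n IH] in b A *.
  move=> mA /=; rewrite expr0 invr1 mul1e /dirac !indicE; congr (_%:R%:E).
  congr (nat_of_bool _); apply/idP/idP; rewrite !inE/=; congr A; apply/rowP; case=> //.
move=> mA.
pose b' := \row_(i < n) b ord0 (lift ord0 i).
pose phi (z : measurableTypeR R * 'rV[R]_n) : measurableTypeR R * 'rV[R]_n :=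
  (c * z.1 + b ord0 ord0, c *: z.2 + b').
have mphi : measurable_fun setT phi.
  apply: measurable_fun_pair => /=.
    by apply: measurable_funD => //; apply: measurable_funM.
  apply: measurable_fun_rV => i.
  rewrite (_ : _ \o _ = fun z => c * coord_rV i z.2 + b' ord0 i); last first.
    by apply/funext => z /=; rewrite /coord_rV !mxE.
  apply: measurable_funD => //; apply: measurable_funM => //.
  by apply: measurableT_comp => //; exact: measurable_coord_rV.
pose mu : {measure set (measurableTypeR R * 'rV[R]_n) -> \bar R} :=
  (lebesgue_measure \x borel_lebesgue_rV R n)%E.
pose m := measure_function_pushforward__canonical__measure_function_Measure mu mphi.
have cn0 : 0 < c ^+ n.+1 by rewrite exprn_gt0.
pose m' := mscale (NngNum (ltW cn0)) m.
have mcons : measurable (@cons_rV R n @^-1` A).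
  by rewrite -[X in measurable X]setTI; exact: measurable_cons_rV.
have H : mu (@cons_rV R n @^-1` A) = m' (@cons_rV R n @^-1` A).
  apply: product_measure_unique => // X Y mX mY.
  pose X' := (fun x : R => c * x + b ord0 ord0) @^-1` X.
  pose Y' := (fun x : 'rV[R]_n => c *: x + b') @^-1` Y.
  transitivity ((c ^+ n.+1)%:E * mu (X' `*` Y'))%E; first by [].
  rewrite /mu/= product_measure1E//; last 2 first.
  - rewrite -[X in measurable X]setTI; apply: (_ : measurable_fun setT _) => //.
    by apply: measurable_funD => //; exact: measurable_funM.
  - rewrite -[X in measurable X]setTI; apply: (_ : measurable_fun setT _) => //.
    apply: measurable_fun_rV => i.
    rewrite (_ : _ \o _ = fun z => c * coord_rV i z + b' ord0 i); last first.
      by apply/funext => z /=; rewrite /coord_rV !mxE.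
    apply: measurable_funD => //; apply: measurable_funM => //.
    exact: measurable_coord_rV.
  rewrite /= lebesgue_measure_affine// IH//.
  rewrite [(_ * _ * (_ * _))%E]muleACA.
  transitivity ((c ^+ n.+1 * (c^-1 * c ^- n))%:E *
    (lebesgue_measure X * borel_lebesgue_rV R n Y))%E; first by rewrite [in RHS]EFinM -[RHS]muleA.
  by rewrite -invfM -exprS divff ?mul1e// gt_eqF.
rewrite -[RHS]/((c ^- n.+1)%:E * mu (@cons_rV R n @^-1` A))%E H.
rewrite /m' /mscale /= /pushforward muleA -EFinM mulVf ?gt_eqF// mul1e.
rewrite -[LHS]/(mu (@cons_rV R n @^-1` _)) /mu/=.
have E z : c *: cons_rV z + b = cons_rV (phi z).
  apply/rowP => i; rewrite [LHS]mxE [X in X + _]mxE.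
  case: (unliftP ord0 i) => [j|] ->; first by rewrite !cons_rVS !mxE.
  by rewrite !cons_rV0.
by congr (_ _); apply/funext => z; rewrite /preimage /mkset /= E.
Qed.

(** A small displacement of the combined point is absorbed by moving [p] alone, the displacement
    being divided by [1 - l]. *)
Lemma convex_interior_segment (R : realType) (n : nat) (D : set 'rV[R]_n)
    (p z : 'rV[R]_n) (l : R) :
  (forall x y l, D x -> D y -> 0 < l < 1 -> D ((1 - l) *: x + l *: y)) ->
  interior D p -> D z -> 0 < l < 1 -> interior D ((1 - l) *: p + l *: z).
Proof.
move=> cD /interior_rV[e [e0 eD]] Dz l01; have /andP[l0 l1] := l01.
have l1' : 0 < 1 - l by rewrite subr_gt0.
apply/interior_rV; exists ((1 - l) * e); split; first exact: mulr_gt0.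
move=> y yw.
have -> : y = (1 - l) *: ((1 - l)^-1 *: (y - l *: z)) + l *: z.
  by rewrite scalerA divff ?scale1r ?subrK// gt_eqF.
apply: cD => //; apply: eD => i.
rewrite -(ltr_pM2l l1') -[X in X * _](gtr0_norm l1') -normrM.
apply: le_lt_trans (yw i); rewrite le_eqVlt; apply/orP; left; apply/eqP.
by congr (`|_|); rewrite !mxE; field; rewrite gt_eqF.
Qed.

Lemma rV_bounded_finite_measure (R : realType) (n : nat) (M : R) (A : set 'rV[R]_n) :
  measurable A -> (forall x, A x -> forall i, `|x ord0 i| <= M) ->
  (borel_lebesgue_rV R n A < +oo)%E.
Proof.
move=> mA AM; have [->|/set0P[x0 Ax0]] := eqVneq A set0; first by rewrite measure0.
pose a : 'rV[R]_n := const_mx (- `|M| - 1); pose b : 'rV[R]_n := const_mx `|M|.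
pose B := [set x : 'rV[R]_n | forall i, a ord0 i < x ord0 i <= b ord0 i].
apply: (@le_lt_trans _ _ (borel_lebesgue_rV R n B)).
  apply: le_measure; rewrite ?inE//; first exact: measurable_rV_box.
  move=> x /AM xM i; have := le_trans (xM i) (ler_norm M).
  by rewrite !mxE ler_norml => /andP[h1 h2]; apply/andP; split; lra.
rewrite borel_lebesgue_rV_box ?ltry// => i; rewrite !mxE.
by have := normr_ge0 M; lra.
Qed.

(** A convex function lies below its chord on [[0, 1]]. This bounds explicitly the growth of volume
    under a dilation of factor [1 + x]. *)
Lemma expr1D_le (R : realType) (n : nat) (x : R) : 0 <= x <= 1 ->
  (1 + x) ^+ n <= 1 + x * (2 ^+ n - 1).
Proof.
move=> /andP[x0 x1]; elim: n => [|n IH]; first by rewrite !expr0 subrr mulr0 addr0.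
rewrite !exprS; apply: (@le_trans _ _ ((1 + x) * (1 + x * (2 ^+ n - 1)))).
  by rewrite ler_wpM2l// addr_ge0.
have : 1 <= 2 ^+ n :> R by apply: exprn_ege1; lra.
set w := 2 ^+ n => w1.
have : 0 <= x * (w - 1) * (1 - x) by rewrite !mulr_ge0// subr_ge0.
by lra.
Qed.

(* Dilating the interior about one of its points by any factor [c > 1] covers the
   set, while the measure only grows by the factor [c ^+ n]. *)
Lemma convex_boundary_null (R : realType) (n : nat) (D : set 'rV[R]_n) (M : R) :
  (forall x y l, D x -> D y -> 0 < l < 1 -> D ((1 - l) *: x + l *: y)) ->
  (forall x, D x -> forall i, `|x ord0 i| <= M) ->
  interior D !=set0 ->
  exists N, [/\ measurable N, borel_lebesgue_rV R n N = 0%E & D `\` interior D `<=` N].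
Proof.
move=> cD DM [p pU]; set U := interior D.
have oU : open U by exact: open_interior.
have mU : measurable U by exact: rV_open_measurable.
have Ufin : (borel_lebesgue_rV R n U < +oo)%E.
  by apply: (rV_bounded_finite_measure _ _ M) => // x /interior_subset; exact: DM.
pose c (k : nat) : R := 1 + k.+1%:R^-1.
have k0 (k : nat) : 0 < k.+1%:R^-1 :> R by rewrite invr_gt0 ltr0n.
have k1 (k : nat) : k.+1%:R^-1 <= 1 :> R by rewrite invf_le1 ?ltr0n// ler1n.
have c0 k : 0 < c k by rewrite addr_gt0.
(* [V k] is the dilation of [U] about [p] by the factor [c k], as a preimage under the inverse
   map. *)
pose V k := (fun z : 'rV[R]_n => (c k)^-1 *: z + (1 - (c k)^-1) *: p) @^-1` U.
have mV k : measurable (V k).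
  rewrite -[X in measurable X]setTI; apply: (_ : measurable_fun setT _) => //.
  apply: measurable_fun_rV => i.
  rewrite (_ : _ \o _ = fun z => (c k)^-1 * coord_rV i z + ((1 - (c k)^-1) *: p) ord0 i);
    last by apply/funext => z /=; rewrite /coord_rV !mxE.
  apply: measurable_funD => //; apply: measurable_funM => //.
  exact: measurable_coord_rV.
have ck01 k : 0 < (c k)^-1 < 1.
  by rewrite invr_gt0 c0 invf_lt1 ?c0// /c ltrDl k0.
have DV k : D `<=` V k.
  move=> z Dz; rewrite /V /preimage/= addrC.
  exact: convex_interior_segment.
have muV k : borel_lebesgue_rV R n (V k) = ((c k ^+ n)%:E * borel_lebesgue_rV R n U)%E.
  by rewrite borel_lebesgue_rV_affine ?invr_gt0// exprVn invrK.
pose N := (\bigcap_k V k) `\` U.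
have mN : measurable N.
  by apply: measurableD => //; exact: bigcapT_measurable.
exists N; split => //; last first.
  by move=> x [Dx nUx]; split => // k _; exact: DV.
(* [N] and [U] are disjoint and both lie in [V k]; since [c k] tends to 1, no room is left for
   [N]. *)
have NU k : (borel_lebesgue_rV R n N + borel_lebesgue_rV R n U <=
    (c k ^+ n)%:E * borel_lebesgue_rV R n U)%E.
  rewrite -muV -measureU//; last by rewrite setDKI.
  apply: le_measure; rewrite ?inE//; first exact: measurableU.
  move=> x [[+ _]|Ux]; first exact.
  by apply: DV; exact: interior_subset.
have Ufin' : borel_lebesgue_rV R n U \is a fin_num by rewrite ge0_fin_numE.
have Nfin : borel_lebesgue_rV R n N \is a fin_num.
  rewrite ge0_fin_numE//.
  apply: (@le_lt_trans _ _ (borel_lebesgue_rV R n N + borel_lebesgue_rV R n U)%E).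
    by rewrite leeDl.
  by apply: le_lt_trans (NU 0) _; rewrite lte_mul_pinfty// lee_fin exprn_ge0// ltW.
set u := fine (borel_lebesgue_rV R n U); set v := fine (borel_lebesgue_rV R n N).
have u0 : 0 <= u by exact: fine_ge0.
have v0 : 0 <= v by exact: fine_ge0.
have vk k : v <= k.+1%:R^-1 * (2 ^+ n - 1) * u.
  have := NU k; rewrite -(fineK Ufin') -(fineK Nfin) -/u -/v -EFinD -EFinM lee_fin.
  have := expr1D_le R n k.+1%:R^-1; rewrite (ltW (k0 k)) k1 => /(_ isT) h.
  have {h} : c k ^+ n * u <= (1 + k.+1%:R^-1 * (2 ^+ n - 1)) * u by exact: ler_wpM2r.
  by set w := c k ^+ n; set z := 2 ^+ n; set y := k.+1%:R^-1; lra.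
rewrite -(fineK Nfin) -/v; congr EFin; apply/eqP; rewrite eq_le v0 andbT leNgt.
apply/negP => v_gt0.
have := truncnS_gt ((2 ^+ n - 1) * u / v).
rewrite ltr_pdivrMr// -(ltr_pdivrMl _ _ (ltr0Sn R _)) mulrA ltNge => /negP; apply.
exact: vk.
Qed.

(** * Log-concave functions *)

(** For [0 < l < 1] the product is 0 as soon as one value is 0, so the zero convention of
    [power_mean] is built in. *)
Definition log_concave (R : realType) (n : nat) (g : 'rV[R]_n -> R) : Prop :=
  forall x y l, 0 < l < 1 -> g x `^ (1 - l) * g y `^ l <= g ((1 - l) *: x + l *: y).

Lemma powR_split (R : realType) (a l : R) : 0 < a -> a `^ (1 - l) * a `^ l = a.
Proof.
by move=> a0; rewrite -powRD ?subrK ?powRr1 ?(ltW a0)//; rewrite (gt_eqF a0) implybT.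
Qed.

(** A cube is the convex hull of its vertices: a point lies on a segment in one coordinate direction
    between two opposite faces, and the coordinates are treated one by one. *)
Lemma convex_cube (R : realType) (n : nat) (C : set 'rV[R]_n) (p : 'rV[R]_n) (e : R) :
  (forall x y l, C x -> C y -> 0 < l < 1 -> C ((1 - l) *: x + l *: y)) -> 0 < e ->
  (forall v : 'rV[R]_n, (forall i, v ord0 i = p ord0 i - e \/ v ord0 i = p ord0 i + e) -> C v) ->
  forall y : 'rV[R]_n, (forall i, `|y ord0 i - p ord0 i| <= e) -> C y.
Proof.
move=> cC e0 vC.
(* Only the first [k] coordinates may be non-extreme; the induction step deals with coordinate
   number [k]. *)
suff H (k : nat) : forall y : 'rV[R]_n, (forall i, `|y ord0 i - p ord0 i| <= e) ->
    (forall i : 'I_n, (k <= i)%N -> y ord0 i = p ord0 i - e \/ y ord0 i = p ord0 i + e) -> C y.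
  by move=> y ye; apply: (H n) => // i; rewrite leqNgt ltn_ord.
elim: k => [|k IH] y ye yk; first by apply: vC => i; exact: yk.
have [nk|kn] := leqP n k.
  by apply: IH => // i ki; have := leq_trans nk ki; rewrite leqNgt ltn_ord.
pose j := Ordinal kn.
have bdry : y ord0 j = p ord0 j - e \/ y ord0 j = p ord0 j + e -> C y.
  move=> yj; apply: IH => // i; rewrite leq_eqVlt => /orP[/eqP ki|]; last exact: yk.
  by have -> : i = j by exact/val_inj.
have [yj|yjN] := pselect (y ord0 j = p ord0 j - e); first by apply: bdry; left.
have [yj|yjP] := pselect (y ord0 j = p ord0 j + e); first by apply: bdry; right.
pose face (s : R) : 'rV[R]_n := \row_i (if i == j then p ord0 j + s else y ord0 i).
have Cface s : s = - e \/ s = e -> C (face s).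
  move=> se; apply: IH => i.
    rewrite mxE; case: eqP => [->|_]; last exact: ye.
    rewrite [_ + s]addrC addrK.
    by case: se => ->; rewrite ?normrN gtr0_norm.
  rewrite leq_eqVlt => /orP[/eqP ki|ki].
    have -> : i = j by exact/val_inj.
    by rewrite mxE eqxx; case: se => ->; [left|right].
  by rewrite mxE; case: eqP => [ij|_]; [rewrite ij ltnn in ki|exact: yk].
have /andP[h1 h2] : - e <= y ord0 j - p ord0 j <= e by rewrite -ler_norml.
have h1' : - e < y ord0 j - p ord0 j.
  by rewrite lt_neqAle h1 andbT; apply/eqP => E; apply: yjN; rewrite E; ring.
have h2' : y ord0 j - p ord0 j < e.
  by rewrite lt_neqAle h2 andbT; apply/eqP => E; apply: yjP; rewrite -E; ring.
(* The relative position of [y] between the two faces; it is strictly between 0 and 1 since the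
   extreme positions have been excluded. *)
pose l := (y ord0 j - p ord0 j + e) / (2 * e).
have l01 : 0 < l < 1.
  by rewrite divr_gt0 ?ltr_pdivrMr//=; lra.
have -> : y = (1 - l) *: face (- e) + l *: face e.
  apply/rowP => i; rewrite !mxE; case: eqP => [->|_]; last by ring.
  by rewrite /l; field; rewrite gt_eqF.
by apply: cC => //; apply: Cface; [left|right].
Qed.

Lemma log_concave_superlevel (R : realType) (n : nat) (g : 'rV[R]_n -> R) (m : R) :
  log_concave R n g -> 0 < m -> forall x y l,
  m <= g x -> m <= g y -> 0 < l < 1 -> m <= g ((1 - l) *: x + l *: y).
Proof.
move=> cg m0 x y l mx my l01; have /andP[l0 l1] := l01.
apply: le_trans (cg x y l l01); rewrite -[leLHS](powR_split _ _ l m0).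
have gx0 := lt_le_trans m0 mx; have gy0 := lt_le_trans m0 my.
by apply: ler_pM; rewrite ?powR_ge0// ge0_ler_powR ?nnegrE ?subr_ge0// ltW.
Qed.

(** The minimum of [g] over the finitely many vertices of a small cube is positive, and the
    corresponding superlevel set is convex, hence contains the cube. *)
Lemma log_concave_locally_bounded_below (R : realType) (n : nat) (g : 'rV[R]_n -> R)
    (p : 'rV[R]_n) :
  log_concave R n g -> (forall x, 0 <= g x) ->
  interior [set x | g x != 0] p -> exists e m : R, [/\ 0 < e, 0 < m &
    forall y : 'rV[R]_n, (forall i, `|y ord0 i - p ord0 i| <= e) -> m <= g y].
Proof.
move=> cg g0 /interior_rV[e0 [e0_gt0 eD]].
pose e := e0 / 2; have e_gt0 : 0 < e by rewrite divr_gt0.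
pose vert (v : {ffun 'I_n -> bool}) : 'rV[R]_n :=
  \row_i (p ord0 i + (if v i then e else - e)).
pose m := \big[Num.min/1]_v g (vert v).
have m0 : 0 < m.
  apply/bigmin_gtP; split => // v _; rewrite lt0r g0 andbT; apply: eD => i.
  rewrite mxE [_ + (if _ then _ else _)]addrC addrK.
  by case: (v i); rewrite ?normrN gtr0_norm// /e; lra.
exists e, m; split => //.
apply: (@convex_cube R n [set y | m <= g y] p e) => //=.
  by move=> x y l /= *; apply: log_concave_superlevel.
move=> v vE; have -> : v = vert [ffun i => v ord0 i == p ord0 i + e].
  apply/rowP => i; rewrite mxE ffunE; case: eqP => // vN.
  by case: (vE i) => // ->.
exact: bigmin_le.
Qed.

Section interior_restriction.
Context (R : realType) (n : nat) (g : 'rV[R]_n -> R).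
Hypotheses (cg : log_concave R n g) (g0 : forall x, 0 <= g x).

Let D := [set x | g x != 0].

Lemma log_concave_support_convex x y l : D x -> D y -> 0 < l < 1 ->
  D ((1 - l) *: x + l *: y).
Proof.
move=> Dx Dy l01; apply: lt0r_neq0; apply: lt_le_trans (cg x y l l01).
by rewrite mulr_gt0// powR_gt0// lt0r g0 andbT.
Qed.

Lemma log_concave_interior_restriction : log_concave R n (g \_ (interior D)).
Proof.
move=> x y l l01; have /andP[l0 l1] := l01.
have l1' : 0 < 1 - l by rewrite subr_gt0.
have r0 z : 0 <= (g \_ (interior D)) z by rewrite patchE; case: ifPn.
rewrite [in X in X * _]patchE; case: ifPn => [|_]; last by rewrite powR0 ?gt_eqF// mul0r.
rewrite inE => Ux; rewrite [in X in _ * X]patchE; case: ifPn => [|_]; last first.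
  by rewrite [X in _ * X]powR0 ?gt_eqF// mulr0.
rewrite inE => Uy; rewrite patchE ifT; first exact: cg.
rewrite inE; apply: convex_interior_segment => //; last exact: interior_subset.
exact: log_concave_support_convex.
Qed.

(** Lower semicontinuity: a point [y] near [p] is [(1 - d) p + d w] with [w] in a cube where
    [g >= m], so [g y] is at least [g p ^ (1 - d) * m ^ d], which exceeds [r] for small [d]. *)
Lemma open_interior_restriction_superlevel (r : R) : 0 <= r ->
  open [set x | r < (g \_ (interior D)) x].
Proof.
move=> r0; rewrite openE => p /=; rewrite patchE; case: ifPn; last by rewrite ltNge r0.
rewrite inE => Up rg.
have [e [m [e0 m0 em]]] := log_concave_locally_bounded_below _ _ _ _ cg g0 Up.
have gp0 : 0 < g p by exact: le_lt_trans rg.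
pose L := `|ln (m / g p)| + 1.
have L0 : 0 < L by rewrite ltr_wpDl.
(* Since [(m / g p) ^ d >= 1 - d * L], this [d] loses at most half of the gap [g p - r]. *)
pose d := Num.min (1 / 2) ((g p - r) / (2 * g p * L)).
have gpL : 0 < 2 * g p * L by rewrite !mulr_gt0.
have d01 : 0 < d < 1.
  rewrite lt_min gt_min; apply/andP; split; last by apply/orP; left; lra.
  by apply/andP; split; [lra|rewrite divr_gt0// subr_gt0].
have /andP[d0 d1] := d01.
have gain : r < g p `^ (1 - d) * m `^ d.
  have -> : g p `^ (1 - d) * m `^ d = g p * (m / g p) `^ d.
    rewrite -[X in _ = X * _](powR_split _ _ d gp0) -mulrA; congr (_ * _).
    by rewrite -powRM ?ltW// ?divr_gt0// mulrC divfK// gt_eqF.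
  have mg0 : 0 < m / g p by rewrite divr_gt0.
  have h1 : 1 - d * L <= (m / g p) `^ d.
    rewrite /powR gt_eqF//; apply: le_trans (expR_ge1Dx _).
    rewrite lerD2l -mulrN ler_wpM2l ?(ltW d0)// lerNl /L.
    by have := ler_norm (- ln (m / g p)); rewrite normrN; lra.
  have h2 : d * (2 * g p * L) <= g p - r.
    by rewrite -ler_pdivlMr// ge_min lexx orbT.
  have := ler_wpM2l (ltW gp0) h1.
  have : d * (g p * L) * 2 <= g p - r by lra.
  set q := _ `^ _; move=> h3 h4; lra.
have [e2 [e20 e2U]] := open_rV_box _ _ _ _ (@open_interior _ D) Up.
(* Radius [d * e] puts [w] within [e] of [p], and [e2] keeps [y] in the interior of the support. *)
apply/interior_rV; exists (Num.min (d * e) e2).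
split; first by rewrite lt_min e20 mulr_gt0.
move=> y yp; rewrite /= patchE ifT; last first.
  by rewrite inE; apply: e2U => i; have := yp i; rewrite lt_min => /andP[].
apply: lt_le_trans gain _.
have -> : y = (1 - d) *: p + d *: (p + d^-1 *: (y - p)).
  by apply/rowP => i; rewrite !mxE; field; rewrite gt_eqF.
apply: le_trans (cg _ _ _ d01); rewrite ler_wpM2l ?powR_ge0//.
apply: ge0_ler_powR; rewrite ?nnegrE ?(ltW d0) ?(ltW m0)//.
apply: em => i; rewrite !mxE [p ord0 i + _]addrC addrK normrM gtr0_norm ?invr_gt0//.
by rewrite mulrC ler_pdivrMr// mulrC; have := yp i; rewrite lt_min => /andP[/ltW].
Qed.

(** Superlevel sets are open for levels [a >= 0] and the whole space for [a < 0]. *)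
Lemma measurable_interior_restriction : measurable_fun setT (g \_ (interior D)).
Proof.
move=> mD; apply: (measurability _ (RGenOInfty.measurableE R)) => //.
move=> /= _ [_ [a ->]] <-; rewrite setTI.
have [a0|a0] := leP 0 a.
  rewrite (_ : _ @^-1` _ = [set x | a < (g \_ (interior D)) x]).
    by apply: rV_open_measurable; exact: open_interior_restriction_superlevel.
  by apply/seteqP; split=> x /=; rewrite in_itv/= andbT.
rewrite (_ : _ @^-1` _ = setT); first exact: measurableT.
apply/seteqP; split=> x //= _; rewrite in_itv/= andbT (lt_le_trans a0)//.
by rewrite patchE; case: ifPn.
Qed.

(** Prolong the segment from [z] to [p] slightly beyond [p], to a point [w] where [g >= m].
    Log-concavity at [p], between [w] and [z], bounds [g z] by a constant, as the weight [d] does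
    not depend on [z]. *)
Lemma log_concave_bounded (M : R) :
  (forall x, D x -> forall i, `|x ord0 i| <= M) -> interior D !=set0 ->
  exists K, forall x, g x <= K.
Proof.
move=> DM [p Up].
have [e [m [e0 m0 em]]] := log_concave_locally_bounded_below _ _ _ _ cg g0 Up.
have Dp := interior_subset Up.
(* [S] exceeds every coordinate difference of two points of the support, so [w] stays within [e] of
   [p]. *)
pose S := 2 * `|M| + 1; have S0 : 0 < S by have := normr_ge0 M; rewrite /S; lra.
pose d := e / (e + S).
have eS : 0 < e + S by rewrite addr_gt0.
have d0 : 0 < d by rewrite divr_gt0.
have d1 : d < 1 by rewrite ltr_pdivrMr// mul1r ltrDl.
pose K := (g p / m `^ (1 - d)) `^ d^-1.
exists K => z; have [->|gz] := eqVneq (g z) 0; first exact: powR_ge0.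
have gz0 : 0 < g z by rewrite lt0r gz g0.
pose w := p - (e / S) *: (z - p).
have mw : m <= g w.
  apply: em => i; rewrite !mxE [p ord0 i + _]addrC addrK normrN normrM gtr0_norm ?divr_gt0//.
  rewrite mulrAC ler_pdivrMr// ler_wpM2l ?(ltW e0)//.
  have h1 := DM _ gz i; have h2 := DM _ Dp i.
  apply: le_trans (ler_normB _ _) _; rewrite /S.
  by have := ler_norm M; lra.
have E : p = (1 - d) *: w + d *: z.
  apply/rowP => i; rewrite !mxE /d; field; apply/andP; split; rewrite gt_eqF//.
have := cg w z d; rewrite -E d0 d1 => /(_ isT) H.
have m1 : 0 < m `^ (1 - d) by exact: powR_gt0.
have H' : g z `^ d <= g p / m `^ (1 - d).
  rewrite ler_pdivlMr// mulrC; apply: le_trans H; rewrite ler_wpM2r ?powR_ge0//.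
  by apply: ge0_ler_powR; rewrite ?nnegrE ?subr_ge0// ltW.
have -> : g z = (g z `^ d) `^ d^-1.
  by rewrite -powRrM divff ?gt_eqF// powRr1// ltW.
apply: ge0_ler_powR; rewrite ?nnegrE ?powR_ge0 ?invr_ge0 ?(ltW d0)//.
by rewrite divr_ge0// ltW.
Qed.

End interior_restriction.

(** * Integration with respect to a completed measure *)

Section integral_completion.
Context d (T : measurableType d) (R : realType) (mu : {measure set T -> \bar R}).
Local Notation cmu := (@completed_measure_extension _ _ _ mu).
Local Notation cT := (caratheodory_type (mu^*)%mu).

Lemma measurable_fun_completed (f : T -> \bar R) :
  measurable_fun setT f -> measurable_fun setT (f : cT -> \bar R).
Proof.
move=> mf _ Y mY; rewrite setTI; apply: caratheodory_measurable_mu_ext.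
by rewrite -[X in measurable X]setTI; exact: mf.
Qed.

(** The identity map is measurable from the completed space to the original one and pushes the
    completed measure forward to [mu]. *)
Lemma ge0_integral_completed (f : T -> \bar R) :
  measurable_fun setT f -> (forall x, 0 <= f x)%E ->
  (\int[cmu]_(x in (setT : set cT)) f x = \int[mu]_x f x)%E.
Proof.
move=> mf f0; pose phi : cT -> T := id.
have mphi : measurable_fun setT phi.
  by move=> _ Y mY; rewrite setTI; apply: caratheodory_measurable_mu_ext.
transitivity (\int[pushforward cmu phi]_x f x)%E.
  by rewrite ge0_integral_pushforward.
by apply: eq_measure_integral => // A mA _; exact: measurable_mu_extE.
Qed.

(** Only [f] is assumed measurable; completeness passes measurability on to [k]. This allows a Borel
    function to replace the given one. *)
Lemma ge0_integral_completed_ae (f k : T -> \bar R) (N : set T) :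
  measurable_fun setT f -> (forall x, 0 <= f x)%E -> (forall x, 0 <= k x)%E ->
  measurable N -> mu N = 0%E -> (forall x, ~ N x -> f x = k x) ->
  (\int[cmu]_(x in (setT : set cT)) k x = \int[mu]_x f x)%E.
Proof.
move=> mf f0 k0 mN N0 fk; rewrite -ge0_integral_completed//.
have fkae : ae_eq cmu setT (f : cT -> \bar R) k.
  exists N; split; first exact: caratheodory_measurable_mu_ext.
    by rewrite -N0; exact: measurable_mu_extE.
  by move=> x /= h; apply: contrapT => nN; apply: h => _; exact: fk.
have mf' := measurable_fun_completed _ mf.
have cc : measure_is_complete cmu by exact: measure_is_complete_caratheodory.
apply/esym/ge0_ae_eq_integral => //.
exact: ae_measurable_fun fkae mf'.
Qed.

End integral_completion.

(** * The heat kernel *)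

Lemma boxedW (R : realType) (n : nat) (M M' : R) (f : 'rV[R]_n -> R) :
  M <= M' -> boxed R n M f -> boxed R n M' f.
Proof.
move=> MM' [mf f0M fM]; split => // x.
  by have /andP[-> /= h] := f0M x; exact: le_trans MM'.
by move=> /fM h i; exact: le_trans MM'.
Qed.

(** If the integral of [h - f] were 0, this difference would vanish almost everywhere, but it is
    positive on [V], which has positive measure. *)
Lemma boxed_integral_lt (R : realType) (n : nat) (M : R) (f h : 'rV[R]_n -> R)
    (V : set 'rV[R]_n) :
  boxed R n M f -> boxed R n M h -> (forall x, f x <= h x) ->
  open V -> V !=set0 -> (forall x, V x -> f x < h x) ->
  \int[borel_lebesgue_rV R n]_x f x < \int[borel_lebesgue_rV R n]_x h x.
Proof.
move=> bf bh fh oV V0 fhV.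
have [mf f0M fM] := bf; have [mh h0M hM] := bh.
have f0 x : 0 <= f x by case/andP: (f0M x).
pose k x := h x - f x.
have mk : measurable_fun setT k by exact: measurable_funB.
have k0 x : 0 <= k x by rewrite subr_ge0.
have bk : boxed R n M k.
  split => // x.
    rewrite k0/= lerBlDr; case/andP: (h0M x) => _ /le_trans; apply.
    by rewrite lerDl.
  rewrite subr_eq0 => hf; have [hx|/hM//] := eqVneq (h x) 0.
  by apply: fM; apply: contra hf => /eqP ->; rewrite hx.
have [K [_ HK]] := boxed_integral R n M.
have [ffin _] := HK _ bf; have [kfin _] := HK _ bk.
have E : (\int[borel_lebesgue_rV R n]_x (h x)%:E =
    \int[borel_lebesgue_rV R n]_x (f x)%:E + \int[borel_lebesgue_rV R n]_x (k x)%:E)%E.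
  rewrite -ge0_integralD//; last 4 first.
  - by move=> x _; rewrite lee_fin.
  - exact/measurable_EFinP.
  - by move=> x _; rewrite lee_fin.
  - exact/measurable_EFinP.
  by apply: eq_integral => x _; rewrite -EFinD /k addrC subrK.
have -> : \int[borel_lebesgue_rV R n]_x h x = \int[borel_lebesgue_rV R n]_x f x +
    \int[borel_lebesgue_rV R n]_x k x by rewrite /Rintegral -fineD// E.
rewrite ltrDl lt0r fine_ge0 ?andbT; last first.
  by apply: integral_ge0 => x _; rewrite lee_fin.
apply/eqP => I0.
have : (\int[borel_lebesgue_rV R n]_x `|(k x)%:E| = 0)%E.
  rewrite -[RHS]/(0%:E) -I0 fineK//; apply: eq_integral => x _.
  by rewrite gee0_abs// lee_fin.
have mk' : measurable_fun setT (EFin \o k) by exact/measurable_EFinP.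
move/(ae_eq_integral_abs (borel_lebesgue_rV R n) measurableT mk').
move=> [N [mN N0 kN]].
have := borel_lebesgue_rV_open_gt0 _ _ _ oV V0; rewrite ltNge => /negP; apply.
rewrite -N0; apply: le_measure; rewrite ?inE//; first exact: rV_open_measurable.
move=> x Vx; apply: kN => /= /(_ Logic.I) [] /eqP; rewrite subr_eq0 => /eqP hf.
by have := fhV _ Vx; rewrite hf ltxx.
Qed.

Section heat_kernel.
Context (R : realType) (n : nat) (t : R).
Hypothesis t0 : 0 < t.

(** The normalizing factor is left out, so the values are at most 1; it is restored at the end as a
    positive constant. *)
Definition heat_kernel (x y : 'rV[R]_n) : R :=
  expR (- euclidean_norm (x - y) ^+ 2 / (4 * t)).

Lemma euclidean_norm_sqr (x : 'rV[R]_n) : euclidean_norm x ^+ 2 = \sum_i x ord0 i ^+ 2.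
Proof. by rewrite sqr_sqrtr// sumr_ge0// => i _; exact: sqr_ge0. Qed.

Lemma heat_kernel_gt0 x y : 0 < heat_kernel x y.
Proof. exact: expR_gt0. Qed.

Lemma heat_kernel_le1 x y : heat_kernel x y <= 1.
Proof.
rewrite -expR0 ler_expR mulNr oppr_le0 divr_ge0 ?sqr_ge0// ltW//.
by rewrite mulr_gt0.
Qed.

Lemma measurable_heat_kernel x : measurable_fun setT (heat_kernel x).
Proof.
apply: measurableT_comp => //; apply: measurable_funM => //.
apply: measurableT_comp => //.
rewrite (_ : (fun _ => _) = fun y => \sum_(i < n) (x ord0 i - coord_rV i y) ^+ 2).
  apply: measurable_sum => i; apply: measurable_funX; apply: measurable_funB => //.
  exact: measurable_coord_rV.
apply/funext => y; rewrite euclidean_norm_sqr; apply: eq_bigr => i _.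
by rewrite !mxE.
Qed.

(* [|u_l|^2 = (1 - l) |u_0|^2 + l |u_1|^2 - l (1 - l) |u_0 - u_1|^2] with [u_j = x_j - y_j]. *)
Lemma heat_kernel_convex (l : R) (x0 x1 y0 y1 : 'rV[R]_n) :
  heat_kernel x0 y0 `^ (1 - l) * heat_kernel x1 y1 `^ l *
    expR (l * (1 - l) * euclidean_norm ((x0 - x1) - (y0 - y1)) ^+ 2 / (4 * t)) =
  heat_kernel ((1 - l) *: x0 + l *: x1) ((1 - l) *: y0 + l *: y1).
Proof.
have powE (a b : R) : expR a `^ b = expR (b * a).
  by rewrite /powR gt_eqF ?expR_gt0// expRK.
rewrite /heat_kernel !powE -!expRD; congr expR.
rewrite !euclidean_norm_sqr !mulrA -!mulrDl; congr (_ / _).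
rewrite !mulrN !mulr_sumr -!sumrN -!big_split/=.
by apply: eq_bigr => i _; rewrite !mxE; ring.
Qed.

End heat_kernel.

(** * Strict log-concavity of the heat integral *)

Section heat_integral.
Context (R : realType) (n : nat) (t M : R) (g : 'rV[R]_n -> R).
Hypotheses (t0 : 0 < t) (bg : boxed R n M g) (cg : log_concave R n g).
Hypotheses (og : open [set x | g x != 0]) (g_neq0 : [set x | g x != 0] !=set0).

Definition heat_integral (x : 'rV[R]_n) : R :=
  \int[borel_lebesgue_rV R n]_y (heat_kernel R n t x y * g y).

Let g0 x : 0 <= g x.
Proof. by case: bg => _ /(_ x) /andP[]. Qed.

Let g_gt0 x : g x != 0 -> 0 < g x.
Proof. by rewrite lt0r g0 andbT. Qed.

Let M0 : 0 <= M.
Proof. by case: bg => _ /(_ 0) /andP[/le_trans h /h]. Qed.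

Lemma boxed_heat_kernel x : boxed R n M (fun y => heat_kernel R n t x y * g y).
Proof.
have [mg g0M gM] := bg; split.
- by apply: measurable_funM => //; exact: measurable_heat_kernel.
- move=> y; rewrite mulr_ge0 ?(ltW (heat_kernel_gt0 _ _ _ _ _))//=.
  apply: le_trans (_ : g y <= _); last by case/andP: (g0M y).
  by rewrite ler_piMl// heat_kernel_le1.
- by move=> y; rewrite mulf_eq0 negb_or => /andP[_ /gM].
Qed.

Lemma heat_integral_gt0 x : 0 < heat_integral x.
Proof.
have -> : 0 = \int[borel_lebesgue_rV R n]_y (fun=> 0 : R) y.
  by rewrite /Rintegral integral0.
apply: (boxed_integral_lt R n M _ _ [set x | g x != 0]) => //.
- by split => // y; rewrite ?lexx ?M0// eqxx.
- exact: boxed_heat_kernel.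
- by move=> y; rewrite mulr_ge0// ltW// heat_kernel_gt0.
- by move=> y /g_gt0 gy; rewrite mulr_gt0// heat_kernel_gt0.
Qed.

(* In coordinate [i] the support of [g] starts at [a := inf]. For [y0] in the slab
   [y0_i < a + (x0_i - x1_i) / 2] and any [y1] in the support, the parallelogram
   term of [heat_kernel_convex] is at least [c], so the first factor can be
   enlarged on the slab before applying the Prekopa-Leindler inequality. *)
Let heat_integral_strict_coord (x0 x1 : 'rV[R]_n) (l : R) (i : 'I_n) : x1 ord0 i < x0 ord0 i -> 0 < l < 1 ->
  heat_integral x0 `^ (1 - l) * heat_integral x1 `^ l <
  heat_integral ((1 - l) *: x0 + l *: x1).
Proof.
move=> x10 l01; have /andP[l0 l1] := l01.
have l1' : 0 < 1 - l by rewrite subr_gt0.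
have [mg g0M gM] := bg.
pose d := x0 ord0 i - x1 ord0 i; have d0 : 0 < d by rewrite subr_gt0.
pose S := [set y ord0 i | y in [set x | g x != 0]].
have infS : has_inf S.
  have [y gy] := g_neq0; split; first by exists (y ord0 i), y.
  exists (- M) => _ [z gz <-]; have := gM _ gz i.
  by rewrite ler_norml => /andP[].
pose a := inf S.
have aS y : g y != 0 -> a <= y ord0 i.
  by move=> gy; apply: inf_lbound; [case: infS|exists y].
have [b0 gb0 b0a] : exists2 b, g b != 0 & b ord0 i < a + d / 2.
  have [|_ [b gb <-] ba] := @inf_lt _ S (a + d / 2) (proj1 infS).
    by rewrite ltrDl divr_gt0.
  by exists b.
pose E := [set y : 'rV[R]_n | y ord0 i < a + d / 2].
have oE : open E.
  rewrite openE => y yE; apply/interior_rV; exists (a + d / 2 - y ord0 i).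
  split; first by rewrite subr_gt0.
  by move=> z /(_ i); rewrite ltr_norml => /andP[_]; rewrite /E/=; lra.
pose c := l * (1 - l) * (d / 2) ^+ 2 / (4 * t).
have c0 : 0 < c.
  by apply: divr_gt0; rewrite ?mulr_gt0 ?exprn_gt0 ?divr_gt0.
(* The first function is raised to the power [1 - l]; the exponent [c / (1 - l)] turns this into a
   gain of exactly [expR c] on the slab. *)
pose F (y : 'rV[R]_n) := if y ord0 i < a + d / 2 then expR (c / (1 - l)) else 1.
have e1 : 1 < expR (c / (1 - l)) by rewrite expR_gt1 divr_gt0.
have F1 y : 1 <= F y by rewrite /F; case: ifPn => // _; exact: ltW.
have Fle y : F y <= expR (c / (1 - l)) by rewrite /F; case: ifPn => // _; exact: ltW.
have F0 y : 0 < F y by exact: lt_le_trans (F1 y).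
pose f0 y := heat_kernel R n t x0 y * g y.
pose f1 y := heat_kernel R n t x1 y * g y.
pose fl y := heat_kernel R n t ((1 - l) *: x0 + l *: x1) y * g y.
pose f0' y := F y * f0 y.
pose M' := expR (c / (1 - l)) * M.
have MM' : M <= M' by rewrite ler_peMl// ltW.
have bf0 : boxed R n M' f0 by exact: boxedW MM' (boxed_heat_kernel x0).
have bf1 : boxed R n M' f1 by exact: boxedW MM' (boxed_heat_kernel x1).
have bfl : boxed R n M' fl by exact: boxedW MM' (boxed_heat_kernel _).
have bf0' : boxed R n M' f0'.
  have [mf0 f0M f0s] := boxed_heat_kernel x0; split.
  - apply: measurable_funM => //; apply: measurable_fun_ifT => //.
    by apply: measurable_fun_ltr => //; exact: measurable_coord_rV.
  - move=> y; have /andP[h1 h2] := f0M y; rewrite mulr_ge0 ?(ltW (F0 y))//=.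
    by apply: ler_pM => //; exact: ltW.
  - move=> y; rewrite mulf_eq0 negb_or => /andP[_ /f0s h] j.
    exact: le_trans MM'.
(* The slab meets the support at [b0], and the intersection is open, so the enlargement strictly
   increases the integral. *)
have f0_lt : heat_integral x0 < \int[borel_lebesgue_rV R n]_y f0' y.
  apply: (boxed_integral_lt R n M' _ _ (E `&` [set y | g y != 0])) => //.
  - move=> y; rewrite -[leLHS]mul1r ler_wpM2r//.
    by rewrite mulr_ge0// ltW// heat_kernel_gt0.
  - exact: openI.
  - by exists b0.
  move=> y [yE /g_gt0 gy]; rewrite -[ltLHS]mul1r ltr_pM2r; last first.
    by rewrite mulr_gt0// heat_kernel_gt0.
  by rewrite /F ifT.
apply: (@lt_le_trans _ _ ((\int[borel_lebesgue_rV R n]_y f0' y) `^ (1 - l) *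
    heat_integral x1 `^ l)).
  rewrite ltr_pM2r ?powR_gt0 ?heat_integral_gt0//.
  have h := heat_integral_gt0 x0; apply: gt0_ltr_powR => //;
  by rewrite nnegrE ltW// (lt_trans h).
apply: (prekopa_leindler R n l M' f0' f1 fl) => // y0 y1.
have [gy0|gy0] := eqVneq (g y0) 0.
  rewrite /f0' /f0 gy0 !mulr0 powR0 ?gt_eqF// mul0r /fl.
  by rewrite mulr_ge0// ltW// heat_kernel_gt0.
have [gy1|gy1] := eqVneq (g y1) 0.
  rewrite /f1 gy1 !mulr0 [X in _ * X]powR0 ?gt_eqF// mulr0 /fl.
  by rewrite mulr_ge0// ltW// heat_kernel_gt0.
have k0 x y : 0 <= heat_kernel R n t x y by rewrite ltW// heat_kernel_gt0.
rewrite /f0' /f0 /f1 /fl !powRM ?mulr_ge0 ?(ltW (F0 y0))//.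
rewrite -heat_kernel_convex//.
set k0' := heat_kernel R n t x0 y0 `^ (1 - l); set k1' := heat_kernel R n t x1 y1 `^ l.
set w := expR (l * _ * _ / _).
(* On the slab, [y1_i >= a] gives [w_i > d / 2] for the vector in the parallelogram term; off the
   slab the left side is 1 and the exponent on the right is nonnegative. *)
have Fw : F y0 `^ (1 - l) <= w.
  rewrite /F; case: ifPn => y0E; last first.
    rewrite powR1 -[leLHS]expR0 ler_expR; apply: divr_ge0; last by rewrite mulr_ge0// ltW.
    by apply: mulr_ge0; [rewrite mulr_ge0// ltW|exact: sqr_ge0].
  rewrite /powR gt_eqF ?expR_gt0// expRK mulrCA divff ?gt_eqF// mulr1 ler_expR.
  rewrite /c ler_wpM2r ?invr_ge0 ?mulr_ge0 ?(ltW t0)//.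
  rewrite ler_wpM2l ?mulr_ge0 ?(ltW l0) ?(ltW l1')//.
  rewrite euclidean_norm_sqr (bigD1 i)//=.
  rewrite -[leLHS]addr0; apply: lerD; last by apply: sumr_ge0 => j _; exact: sqr_ge0.
  rewrite ler_sqr ?nnegrE ?divr_ge0 ?(ltW d0)//; last first.
    by rewrite !mxE; have := aS _ gy1; move: y0E d0; rewrite /d; lra.
  by rewrite !mxE; have := aS _ gy1; move: y0E d0; rewrite /d; lra.
have -> : F y0 `^ (1 - l) * (k0' * g y0 `^ (1 - l)) * (k1' * g y1 `^ l) =
    (k0' * k1' * F y0 `^ (1 - l)) * (g y0 `^ (1 - l) * g y1 `^ l) by ring.
apply: ler_pM; rewrite ?mulr_ge0 ?powR_ge0//.
  by rewrite ler_wpM2l// mulr_ge0 ?powR_ge0.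
exact: cg.
Qed.

(** The points differ in some coordinate; exchanging them together with [l] and [1 - l] gives the
    order required above. *)
Lemma heat_integral_strict (x0 x1 : 'rV[R]_n) (l : R) : x0 != x1 -> 0 < l < 1 ->
  heat_integral x0 `^ (1 - l) * heat_integral x1 `^ l <
  heat_integral ((1 - l) *: x0 + l *: x1).
Proof.
move=> x01 l01; have /andP[l0 l1] := l01.
have [i xi] : exists i, x0 ord0 i != x1 ord0 i.
  apply/existsP; apply: contraR x01; rewrite negb_exists => /forallP H.
  by apply/eqP/rowP => i; apply/eqP/negPn; exact: H.
have [xlt|xgt|xeq] := ltgtP (x0 ord0 i) (x1 ord0 i).
- have l01' : 0 < 1 - l < 1 by apply/andP; split; lra.
  rewrite [ltLHS]mulrC [_ + l *: x1]addrC.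
  have := heat_integral_strict_coord x1 x0 (1 - l) i xlt l01'.
  have -> : 1 - (1 - l) = l by ring.
  by [].
- exact: (heat_integral_strict_coord x0 x1 l i xgt l01).
- by rewrite xeq eqxx in xi.
Qed.

End heat_integral.

(** * From the heat integral to the heat flow *)

Lemma coord_le_norm (R : realType) (n : nat) (x : 'rV[R]_n) (i : 'I_n) :
  `|x ord0 i| <= `|x|.
Proof.
rewrite -[leRHS]/(mx_norm x) mx_normrE.
exact: (le_bigmax _ (fun ij : 'I_1 * 'I_n => `|x ij.1 ij.2|) (ord0, i)).
Qed.

Lemma power_mean0E (R : realType) (a b l : R) : 0 < a -> 0 < b ->
  power_mean 0%:E a b l = a `^ (1 - l) * b `^ l.
Proof.
by move=> a0 b0; rewrite /power_mean mulf_eq0 (gt_eqF a0) (gt_eqF b0) /= eqxx.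
Qed.

Lemma scale_geometric_mean_lt (R : realType) (c a b v l : R) :
  0 < c -> 0 <= a -> 0 <= b -> a `^ (1 - l) * b `^ l < v ->
  (c * a) `^ (1 - l) * (c * b) `^ l < c * v.
Proof.
move=> c0 a0 b0 abv; rewrite !powRM ?(ltW c0)// mulrACA (powR_split _ _ l c0).
by rewrite ltr_pM2l.
Qed.

(** Positivity removes the zero convention of the power mean, so the degenerate cases are equalities
    and only the strict inequality remains to be shown. *)
Lemma strictly_log_concaveP (R : realType) (V : lmodType R) (F : V -> R) :
  (forall x, 0 < F x) ->
  (forall x y (l : R), x != y -> 0 < l < 1 ->
    F x `^ (1 - l) * F y `^ l < F ((1 - l) *: x + l *: y)) ->
  strictly_log_concave setT F.
Proof.
move=> F0 Flt.
have pmE x y l : power_mean 0%:E (F x) (F y) l = F x `^ (1 - l) * F y `^ l.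
  exact: power_mean0E.
have degenerate x y l : [\/ x = y, l = 0 | l = 1] ->
    F ((1 - l) *: x + l *: y) = power_mean 0%:E (F x) (F y) l.
  rewrite pmE; case=> ->.
  - by rewrite -scalerDl subrK scale1r powR_split.
  - by rewrite subr0 scale1r scale0r addr0 powRr1 ?powRr0 ?mulr1// ltW.
  - by rewrite subrr scale1r scale0r add0r powRr1 ?powRr0 ?mul1r// ltW.
have cases (x y : V) (l : R) : 0 <= l <= 1 ->
    [\/ x = y, l = 0 | l = 1] \/ (x != y /\ 0 < l < 1).
  move=> /andP[l0 l1]; have [->|xy] := eqVneq x y; first by left; constructor 1.
  have [->|lN0] := eqVneq l 0; first by left; constructor 2.
  have [->|lN1] := eqVneq l 1; first by left; constructor 3.
  by right; rewrite lt0r lN0 l0 lt_neqAle lN1 l1.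
split; first split.
- by move=> x y l _ _; rewrite inE.
- by move=> x _; exact: ltW.
- move=> x y l _ _ /(cases x y)[/degenerate ->//|[xy l01]].
  by rewrite pmE; apply/ltW; exact: Flt.
move=> x y l _ _ l01; split; last exact: degenerate.
have [//|[xy {}l01]] := cases x y l l01.
by move=> E; have := Flt x y l xy l01; rewrite E pmE ltxx.
Qed.

Theorem proposition3p16 (R : realType) (n : nat) (hn : (0 < n)%N)
    (g : 'rV[R]_n -> R) (g_ge0 : forall x, 0 <= g x)
    (q : \bar R) (hq : q <> -oo%E)
    (g_concave : pconcave q setT g)
    (supp_bounded : bounded_set (~` (g @^-1` [set 0])))
    (supp_interior : interior (~` (g @^-1` [set 0])) !=set0)
    (q_ge0 : (0 <= q)%E)
    (t : R) (ht : 0 < t) :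
  (forall x, 0 < heat_flow g x t) /\
  strictly_log_concave setT (fun x => heat_flow g x t).
Proof.
have cg : log_concave R n g.
  move=> x y l l01; have [_ _ H] := g_concave.
  apply: le_trans (power_mean0_le _ _ _ _ _ q_ge0 (g_ge0 x) (g_ge0 y) l01) _.
  by apply: H => //; case/andP: l01 => /ltW -> /ltW ->.
have DE : ~` (g @^-1` [set 0]) = [set x | g x != 0].
  by apply/seteqP; split=> x /=; [move/eqP|move/eqP].
rewrite DE in supp_bounded supp_interior.
set D := [set x | g x != 0] in supp_bounded supp_interior.
have [M DM] : exists M : R, forall x, D x -> forall i, `|x ord0 i| <= M.
  have [B [_ HB]] := supp_bounded.
  exists (B + 1) => x Dx i; apply: le_trans (HB (B + 1) _ x Dx); last by rewrite ltrDl.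
  exact: coord_le_norm.
have [K gK] := log_concave_bounded _ _ _ cg g_ge0 _ DM supp_interior.
(* [h] is Borel with open support and differs from [g] only on the null set [N]. *)
pose h := g \_ (interior D).
have [N [mN N0 DN]] := convex_boundary_null _ _ _ _
  (log_concave_support_convex _ _ _ cg g_ge0) DM supp_interior.
have h0 x : 0 <= h x by rewrite /h patchE; case: ifPn.
have hg x : ~ N x -> h x = g x.
  move=> nN; rewrite /h patchE; case: ifPn => //; rewrite notin_setE => nU.
  apply/esym/eqP/negPn/negP => Dx; apply: nN; exact: DN.
have hU : [set x | h x != 0] = interior D.
  apply/seteqP; split=> x /=; rewrite /h patchE.
    by case: ifPn; rewrite ?inE// eqxx.
  by move=> Ux; rewrite (mem_set Ux); exact: (interior_subset Ux).
have mh : measurable_fun setT h := measurable_interior_restriction _ _ _ cg g_ge0.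
have ch : log_concave R n h := log_concave_interior_restriction _ _ _ cg g_ge0.
(* One constant for the values and for the coordinates, as [boxed] demands. *)
pose P := Num.max K `|M|.
have bh : boxed R n P h.
  split => // x.
    by rewrite h0 /h patchE; case: ifPn => _; rewrite le_max ?gK ?normr_ge0 ?orbT.
  move=> hx i; have : interior D x by rewrite -hU.
  move=> /interior_subset/DM/(_ i) /le_trans; apply.
  by rewrite le_max ler_norm orbT.
have oh : open [set x | h x != 0] by rewrite hU; exact: open_interior.
have nh : [set x | h x != 0] !=set0 by rewrite hU.
pose c := ((4 * pi * t) `^ (n%:R / 2))^-1.
have c0 : 0 < c.
  by rewrite invr_gt0 powR_gt0// !mulr_gt0// pi_gt0.
(* The completed integral of [g] becomes a Borel integral of [h], to which the iterated-integral
   argument applies. *)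
have flowE x : heat_flow g x t = c * heat_integral R n t h x.
  rewrite /heat_flow -/c; congr (_ * _); rewrite /heat_integral /Rintegral; congr fine.
  pose k y := (heat_kernel R n t x y * h y)%:E.
  have mk : measurable_fun setT k.
    by apply/measurable_EFinP/measurable_funM => //; exact: measurable_heat_kernel.
  apply: (ge0_integral_completed_ae _ _ _ (borel_lebesgue_rV R n) k _ N) => //.
  - by move=> y; rewrite lee_fin mulr_ge0// ltW// heat_kernel_gt0.
  - by move=> y; rewrite lee_fin mulr_ge0// expR_ge0.
  - by move=> y /hg yh; rewrite /k yh.
have I0 x : 0 < heat_integral R n t h x by exact: (heat_integral_gt0 _ _ _ _ _ ht bh oh nh).
have F0 x : 0 < heat_flow g x t by rewrite flowE mulr_gt0.
split => //; apply: strictly_log_concaveP => // x y l xy l01; rewrite !flowE.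
apply: scale_geometric_mean_lt; [exact: c0|exact/ltW/I0|exact/ltW/I0|].
exact: (heat_integral_strict _ _ _ _ _ ht bh ch oh nh).
Qed.
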